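(* There exists an absolute constant $c_1>0$ such that for every $n\geq 1$ and every convex body $K$ in $\mathbb{R}^n$ which contains $0$ in its interior, $$4n\,s(K)^{1/n}\;\geq\; n\,s(K-K)^{1/n}\;\geq\;\frac{c_1}{L_K}.$$
   Context: $\mathbb{R}^n$ carries the standard inner product $\langle\cdot,\cdot\rangle$ and Euclidean norm $\|\cdot\|_2$; $|\cdot|$ denotes volume (Lebesgue measure). A convex body is a compact convex subset of $\mathbb{R}^n$ with non-empty interior. If $0$ is in the interior of $K$, the polar body is $K^{\circ}=\{y\in\mathbb{R}^n:\langle z,y\rangle\leq 1 \text{ for all } z\in K\}$ and the volume product is $s(K)=|K|\,|K^{\circ}|$. $K-K=\{x-y:x,y\in K\}$ is the difference body. Isotropic constant: let $\mathrm{bar}(K)$ be the barycenter of $K$ and $\tilde K=K-\mathrm{bar}(K)$. Then $$L_K=\frac{1}{\sqrt n}\inf_T\left(\frac{1}{|T(\tilde K)|^{1+2/n}}\int_{T(\tilde K)}\|x\|_2^2\,dx\right)^{1/2},$$ where the infimum is over all invertible linear maps $T:\mathbb{R}^n\to\mathbb{R}^n$. An absolute constant does not depend on the dimension $n$ or on the bodies involved. *)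

(* Defs.v *)
From HB Require Import structures.
From mathcomp Require Import all_boot all_order all_algebra.
From mathcomp Require Import all_classical all_reals all_analysis.

Set Implicit Arguments.
Unset Strict Implicit.
Unset Printing Implicit Defensive.

Import Order.TTheory GRing.Theory Num.Theory.
Import numFieldNormedType.Exports.

Local Open Scope classical_set_scope.
Local Open Scope ring_scope.

(* ['rV[R]_n] carries the product sigma-algebra, i.e. the one generated by the
   coordinate functions, exactly as the library does for [n.-tuple R]; as [R]
   is second countable, this is the Borel sigma-algebra of R^n. *)
Definition measure_rV_display : measure_display -> measure_display.
Proof. exact. Qed.

Section measurable_rV.
Context {R : realType} {n : nat}.

Let coord (i : 'I_n) (x : 'rV[R]_n) : R := x ord0 i.

Let rV_set0 : g_sigma_preimage coord set0.
Proof. exact: sigma_algebra0. Qed.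

Let rV_setC A : g_sigma_preimage coord A -> g_sigma_preimage coord (~` A).
Proof. exact: sigma_algebraC. Qed.

Let rV_bigcup (F : _^nat) : (forall i, g_sigma_preimage coord (F i)) ->
  g_sigma_preimage coord (\bigcup_i F i).
Proof. exact: sigma_algebra_bigcup. Qed.

HB.instance Definition _ := @isMeasurable.Build
  (measure_rV_display default_measure_display) 'rV[R]_n
  (g_sigma_preimage coord) rV_set0 rV_setC rV_bigcup.

Lemma measurable_coord_rV (i : 'I_n) :
  measurable_fun [set: 'rV[R]_n] (fun x => x ord0 i).
Proof.
move=> _ Y mY; rewrite setTI; apply: sub_sigma_algebra => /=.
rewrite -bigcup_seq/=; exists i => /=; first by rewrite mem_index_enum.
by exists Y => //; rewrite setTI.
Qed.

Lemma measurable_box (A : 'I_n -> set R) : (forall i, measurable (A i)) ->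
  measurable [set x : 'rV[R]_n | forall i, A i (x ord0 i)].
Proof.
move=> mA; rewrite (_ : mkset _ =
    \bigcap_(i in [set: 'I_n]) ((fun x : 'rV[R]_n => x ord0 i) @^-1` A i)).
  apply: fin_bigcap_measurable => // i _.
  by rewrite -[X in measurable X]setTI; exact: measurable_coord_rV.
by apply/seteqP; split=> [x Ax i _|x Ax i]; exact: Ax.
Qed.

Lemma measurable_fun_rVP d (T : measurableType d) (f : T -> 'rV[R]_n) :
  (forall i, measurable_fun setT (fun t => f t ord0 i)) ->
  measurable_fun setT f.
Proof.
move=> mf _ Y mY; rewrite setTI.
pose F := [set A | measurable (f @^-1` A)].
suff : F Y by [].
move: Y mY; apply: smallest_sub.
  split; first by rewrite /F /= preimage_set0.
  - move=> A FA; rewrite setTD /F /= preimage_setC.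
    by apply: measurableC; exact: FA.
  - move=> A FA; rewrite /F /= preimage_bigcup.
    by apply: bigcup_measurable => k _; exact: FA.
rewrite -bigcup_seq; apply: bigcup_sub => i _ _ [B mB <-].
rewrite /F /= setTI.
by have := mf i measurableT B mB; rewrite setTI.
Qed.

End measurable_rV.

Definition cons_rV (R : realType) (n : nat) (p : R * 'rV[R]_n) : 'rV[R]_n.+1 :=
  row_mx p.1%:M p.2.

Section cons_rV.
Context {R : realType} {n : nat}.
Implicit Types p : R * 'rV[R]_n.

Lemma cons_rV0 p : cons_rV p ord0 ord0 = p.1.
Proof.
rewrite /cons_rV (_ : ord0 = lshift n (ord0 : 'I_1)); last exact: val_inj.
by rewrite (@row_mxEl _ 1 1 n) mxE eqxx.
Qed.

Lemma cons_rVS p i : cons_rV p ord0 (lift ord0 i) = p.2 ord0 i.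
Proof.
rewrite /cons_rV (_ : lift ord0 i = rshift 1 i); last exact: val_inj.
by rewrite (@row_mxEr _ 1 1 n).
Qed.

Lemma measurable_cons_rV : measurable_fun setT (@cons_rV R n).
Proof.
apply: measurable_fun_rVP => i.
case: (unliftP ord0 i) => [j ->|->].
- under eq_fun do rewrite cons_rVS.
  by apply: (measurableT_comp (measurable_coord_rV j)); exact: measurable_snd.
- under eq_fun do rewrite cons_rV0.
  exact: measurable_fst.
Qed.

Definition uncons_rV (x : 'rV[R]_n.+1) : R * 'rV[R]_n :=
  (x ord0 ord0, \row_i x ord0 (lift ord0 i)).

Lemma cons_rVK : cancel (@cons_rV R n) uncons_rV.
Proof.
move=> [a u]; rewrite /uncons_rV cons_rV0; congr (_, _).
by apply/rowP => i; rewrite mxE cons_rVS.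
Qed.

Lemma measurable_uncons_rV : measurable_fun setT uncons_rV.
Proof.
apply: measurable_fun_pair; first exact: measurable_coord_rV.
apply: measurable_fun_rVP => i.
under eq_fun do rewrite mxE.
exact: measurable_coord_rV.
Qed.

End cons_rV.

(* The image of (Lebesgue measure on R) x mu under R x R^n = R^(n+1). *)
Definition lebesgue_cons (R : realType) (n : nat)
    (mu : {sigma_finite_measure set 'rV[R]_n -> \bar R}) :
    set 'rV[R]_n.+1 -> \bar R :=
  pushforward (@lebesgue_measure R \x mu)%E (@cons_rV R n).

Section lebesgue_cons.
Context {R : realType} {n : nat}.
Variable mu : {sigma_finite_measure set 'rV[R]_n -> \bar R}.

Let mcons A : measurable A -> measurable (@cons_rV R n @^-1` A).
Proof.
by move=> mA; rewrite -[X in measurable X]setTI; exact: measurable_cons_rV.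
Qed.

Let lebesgue_cons0 : lebesgue_cons mu set0 = 0%E.
Proof. by rewrite /lebesgue_cons /pushforward preimage_set0 measure0. Qed.

Let lebesgue_cons_ge0 A : (0 <= lebesgue_cons mu A)%E.
Proof. by apply: integral_ge0 => x _; exact: measure_ge0. Qed.

Let lebesgue_cons_sigma_additive : semi_sigma_additive (lebesgue_cons mu).
Proof.
move=> F mF tF mUF; rewrite /lebesgue_cons /pushforward preimage_bigcup.
apply: measure_semi_sigma_additive.
- by move=> k; exact: mcons.
- apply/trivIsetP => /= i j _ _ ij; rewrite -preimage_setI.
  by move/trivIsetP : tF => /(_ _ _ _ _ ij) ->//; rewrite preimage_set0.
- by rewrite -preimage_bigcup; exact: mcons.
Qed.

HB.instance Definition _ := isMeasure.Build _ _ _ (lebesgue_cons mu)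
  lebesgue_cons0 lebesgue_cons_ge0 lebesgue_cons_sigma_additive.

Let lebesgue_cons_sigma_finite : sigma_finite setT (lebesgue_cons mu).
Proof.
have /sigma_finiteP[F [TF ndF Foo]] := sigma_finiteT (@lebesgue_measure R).
have /sigma_finiteP[G [TG ndG Goo]] := sigma_finiteT mu.
exists (fun k => uncons_rV @^-1` (F k `*` G k)).
  apply/esym; rewrite -subTset => x _ /=.
  have : setT (uncons_rV x).1 by []; rewrite TF => -[j _ Fj].
  have : setT (uncons_rV x).2 by []; rewrite TG => -[k _ Gk].
  exists (maxn j k) => //; split.
  - by move: Fj; exact/subsetPset/ndF/leq_maxl.
  - by move: Gk; exact/subsetPset/ndG/leq_maxr.
move=> k; have [mF Fk] := Foo k; have [mG Gk] := Goo k; split.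
  rewrite -[X in measurable X]setTI; apply: measurable_uncons_rV => //.
  exact: measurableX.
rewrite /lebesgue_cons /pushforward -comp_preimage.
rewrite (_ : _ \o _ = id) ?preimage_id; last exact/funext/cons_rVK.
by rewrite product_measure1E// lte_mul_pinfty// ge0_fin_numE.
Qed.

HB.instance Definition _ := Measure_isSigmaFinite.Build _ _ _
  (lebesgue_cons mu) lebesgue_cons_sigma_finite.

End lebesgue_cons.

(* Dimension 0 only seeds the recursion: R^0 is one point of mass 1. *)
Fixpoint lebesgue_rV (R : realType) (n : nat) :
    {sigma_finite_measure set 'rV[R]_n -> \bar R} :=
  if n is m.+1 then lebesgue_cons (lebesgue_rV R m) else \d_(0 : 'rV[R]_0).

(* The values on boxes determine the measure [lebesgue_rV R n]. *)
Lemma lebesgue_rV_box (R : realType) (n : nat) (A : 'I_n -> set R) :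
  (forall i, measurable (A i)) ->
  lebesgue_rV R n [set x : 'rV[R]_n | forall i, A i (x ord0 i)] =
  (\prod_(i < n) @lebesgue_measure R (A i))%E.
Proof.
elim: n => [|n IHn] in A *; move=> mA.
  by rewrite big_ord0 /= diracE mem_set// => -[].
rewrite big_ord_recl -IHn; last by move=> i; exact: mA.
transitivity ((@lebesgue_measure R \x lebesgue_rV R n)%E
    (A ord0 `*`
     [set x : 'rV[R]_n | forall i : 'I_n, A (lift ord0 i) (x ord0 i)]));
  last first.
  rewrite product_measure1E//; first exact: mA.
  exact: (measurable_box (fun i => mA (lift ord0 i))).
apply: (congr1 (@lebesgue_measure R \x lebesgue_rV R n)%E).
apply/seteqP; split=> [p/= Ap|p/= [A0 AS] i].
  by split=> [|i]; [have := Ap ord0|have := Ap (lift ord0 i)];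
    rewrite ?cons_rV0 ?cons_rVS.
by case: (unliftP ord0 i) => [j ->|->]; rewrite ?cons_rV0 ?cons_rVS.
Qed.

Section convex_geometry.
Context {R : realType} {n : nat}.
Implicit Types K A : set 'rV[R]_n.

Definition dotmul (x y : 'rV[R]_n) : R := \sum_i x ord0 i * y ord0 i.

(* The Euclidean norm; the library norm [`|x|] on matrices is the sup norm. *)
Definition norm2 (x : 'rV[R]_n) : R := Num.sqrt (dotmul x x).

(* [fine] sends an infinite volume to 0, which does not occur for the bounded
   sets considered here; the polar is bounded when 0 is interior to [K]. *)
Definition vol A : R := fine (lebesgue_rV R n A).

(* [K°] is the interior, not the polar. *)
Definition convex_body K := [/\ convex_set K, compact K & K° !=set0].

Definition polar K : set 'rV[R]_n :=
  [set y | forall z, K z -> dotmul z y <= 1].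

Definition vol_product K : R := vol K * vol (polar K).

Definition difference_body K : set 'rV[R]_n := [set x - y | x in K & y in K].

Definition barycenter K : 'rV[R]_n :=
  \row_i ((vol K)^-1 * \int[lebesgue_rV R n]_(x in K) x ord0 i).

Definition centered K : set 'rV[R]_n := [set x - barycenter K | x in K].

Definition isotropic_constant K : R :=
  (Num.sqrt n%:R)^-1 *
  inf [set Num.sqrt ((vol (T @` centered K) `^ (1 + 2 / n%:R))^-1 *
         \int[lebesgue_rV R n]_(x in T @` centered K) norm2 x ^+ 2)
      | T in [set T : {linear 'rV[R]_n -> 'rV[R]_n} | bijective T]].

End convex_geometry.

(* Main.v *)
(* For [x = (a - b) / 2] with [a, b] in [K], the intersection of [K] and [x + K]
   contains [(K + a) / 2]; integrating volumes over all such [x] gives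
   [|K - K| <= 4^n |K|]. As [K] is contained in [K - K], the polar of [K - K] is
   contained in that of [K], and the first inequality follows.

   For the second one, [s(K - K)] is invariant under linear maps, so it suffices
   to bound [|(S - S)°|] from below for an arbitrary affine image [S] of [K] in
   terms of its second moment. By Markov's inequality a ball of radius [r]
   comparable to the root mean square norm contains three quarters of [S].
   Disjoint shrunken copies of this part inside [S] bound the entropy numbers:
   [N(S, t r B) <= 4/3 exp(4 n / t)], and the diameter of [S] is at most [7 n r].
   Let [A_k] be the polar of the part of [S - S] inside [64^k r B]. A net of
   [S - S] at scale [t = 16^(k+1)] and the Gaussian tail bound show that a suitable
   dilate of [A_(k+1)] has at least half of the Gaussian mass. Translating a
   symmetric set by [v] multiplies its mass (for the density [exp(-|x|^2)]) by at
   least [exp(-|v|^2)], so few translates of a small multiple of [A_(k+1)] cover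
   the ball [B / (64^k r)]. By duality [A_k] lies in [A_(k+1) + B / (64^k r)],
   whence [|A_k| <= exp(C n / 2^k) |A_(k+1)|]. These losses are summable, [A_0]
   contains [B / r], and [A_k] is the polar of [S - S] once [64^k >= 7 n]. *)
Require Import Defs.
From HB Require Import structures.
From mathcomp Require Import all_boot all_order all_algebra.
From mathcomp Require Import all_classical all_reals all_analysis.
From mathcomp Require Import measurable_realfun.
From mathcomp Require Import ring lra.

Set Implicit Arguments.
Unset Strict Implicit.
Unset Printing Implicit Defensive.

Import Order.TTheory GRing.Theory Num.Theory.
Import numFieldNormedType.Exports.

Local Open Scope classical_set_scope.
Local Open Scope ring_scope.

(** * Linear changes of variables in R^n *)

(** Half-open intervals determine Lebesgue measure, so it is enough that the rescaled image measure
    [nu] gives them their length. *)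
Lemma lebesgue_measure_affine (R : realType) (c d : R)
    (A : set (measurableTypeR R)) : c != 0 -> measurable A ->
  @lebesgue_measure R ((fun x => c * x + d) @^-1` A) =
  (`|c|^-1%:E * @lebesgue_measure R A)%E.
Proof.
move=> c0 mA.
pose phi (x : measurableTypeR R) : measurableTypeR R := c * x + d.
have mphi : measurable_fun setT phi.
  by apply: measurable_funD => //; exact: measurable_funM.
pose nu : {measure set (measurableTypeR R) -> \bar R} :=
  mscale (NngNum (normr_ge0 c))
  (@measure_function_pushforward__canonical__measure_function_Measure
    _ _ _ _ _ (@lebesgue_measure R) phi mphi).
have nuE B : nu B = (`|c|%:E * @lebesgue_measure R (phi @^-1` B))%E by [].
have nc0 : `|c| != 0 by rewrite normr_eq0.
suff : @lebesgue_measure R A = nu A.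
  by move=> ->; rewrite nuE muleA -EFinM mulVf// mul1e.
apply: lebesgue_measure_unique => //.
move=> _ [[a b]] _ <-; rewrite nuE /=.
have [cp|cn|c00] := ltgtP 0 c; last by rewrite c00 eqxx in c0.
- rewrite (_ : phi @^-1` _ = [set` `](c^-1 * (a - d)), (c^-1 * (b - d))]]).
    rewrite !lebesgue_measure_itv /= !lte_fin ltr_pM2l ?invr_gt0// ltrD2r.
    case: ifPn => ab; last by rewrite mule0.
    rewrite -EFinM gtr0_norm//; congr EFin.
    by field.
  apply/seteqP; split => x; rewrite /phi /= !in_itv /=.
    move=> /andP[h1 h2]; rewrite ltr_pdivrMl// ler_pdivlMl//.
    by rewrite ltrBlDr lerBrDr h1.
  rewrite ltr_pdivrMl// ler_pdivlMl//.
  by rewrite ltrBlDr lerBrDr.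
(* A negative slope exchanges the open and the closed endpoint; the length is the same. *)
- rewrite (_ : phi @^-1` _ = [set` `[(c^-1 * (b - d)), (c^-1 * (a - d))[]).
    rewrite !lebesgue_measure_itv /= !lte_fin ltr_nM2l ?invr_lt0// ltrD2r.
    case: ifPn => ab; last by rewrite mule0.
    rewrite -EFinM ltr0_norm//; congr EFin.
    by field.
  apply/seteqP; split => x; rewrite /phi /= !in_itv /=.
    move=> /andP[h1 h2]; rewrite ltr_ndivlMl// ler_ndivrMl//.
    by rewrite ltrBlDr lerBrDr h1 h2.
  rewrite ltr_ndivlMl// ler_ndivrMl//.
  by rewrite ltrBlDr lerBrDr andbC.
Qed.

Section lebesgue_rV_affine.
Context {R : realType}.
Implicit Types n : nat.

(** As preimages are measured, [c] is the inverse of the Jacobian. Measurability is included so that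
    the property passes to compositions. *)
Definition scales_lebesgue n (f : 'rV[R]_n -> 'rV[R]_n) (c : R) :=
  [/\ 0 <= c, measurable_fun setT f &
  forall A, measurable A ->
    lebesgue_rV R n (f @^-1` A) = (c%:E * lebesgue_rV R n A)%E].

Lemma scales_lebesgue_comp n (f g : 'rV[R]_n -> 'rV[R]_n) c d :
  scales_lebesgue f c -> scales_lebesgue g d ->
  scales_lebesgue (g \o f) (c * d).
Proof.
move=> [c0 mf fE] [d0 mg gE]; split; [exact: mulr_ge0|exact: measurableT_comp|].
move=> A mA; rewrite comp_preimage fE.
  by rewrite gE// EFinM muleA.
by rewrite -[X in measurable X]setTI; exact: mg.
Qed.

Lemma measurable_affine n m (M : 'M[R]_(n, m)) (v : 'rV[R]_m) :
  measurable_fun setT (fun x : 'rV[R]_n => x *m M + v).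
Proof.
apply: measurable_fun_rVP => i.
under eq_fun do rewrite !mxE.
apply: measurable_funD => //.
apply: measurable_sum => j.
by apply: measurable_funM => //; exact: measurable_coord_rV.
Qed.

Lemma lebesgue_rVS n (A : set 'rV[R]_n.+1) :
  lebesgue_rV R n.+1 A =
  (@lebesgue_measure R \x lebesgue_rV R n)%E (@cons_rV R n @^-1` A).
Proof. by []. Qed.

Lemma measurable_cons_preimage n (A : set 'rV[R]_n.+1) :
  measurable A -> measurable (@cons_rV R n @^-1` A).
Proof.
by move=> mA; rewrite -[X in measurable X]setTI; exact: measurable_cons_rV.
Qed.

(** Tonelli, slicing by the first coordinate: on the slice at [a] the map is [u *m N] plus the
    translation [a *: b + v], which is why the hypothesis covers all translations. *)
Lemma scales_lebesgue_upper n (b v : 'rV[R]_n) (N : 'M[R]_n) c :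
  (forall w, scales_lebesgue (fun u => u *m N + w) c) ->
  scales_lebesgue
    (fun x : 'rV[R]_n.+1 => x *m (block_mx 1%:M b 0 N : 'M[R]_(1 + n)) +
                            row_mx 0 v) c.
Proof.
move=> Nc; have [c0 _ _] := Nc 0; split => //; first exact: measurable_affine.
move=> A mA; have mA' := measurable_cons_preimage mA.
rewrite !lebesgue_rVS /= /product_measure1.
transitivity (\int[@lebesgue_measure R]_a
   (c%:E * (lebesgue_rV R n \o xsection (@cons_rV R n @^-1` A)) a))%E.
  apply: eq_integral => a _ /=.
  have [_ _ NE] := Nc (a *: b + v).
  rewrite -NE; last exact: measurable_xsection.
  congr (lebesgue_rV R n _); apply/seteqP.
  have E u : (cons_rV (a, u) : 'rV[R]_(1 + n)) *m block_mx 1%:M b 0 N + row_mx 0 v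
      = cons_rV (a, u *m N + (a *: b + v)).
    rewrite /cons_rV /= mul_row_block add_row_mx mulmx1 mulmx0 !addr0.
    by rewrite mul_scalar_mx addrA [u *m N + _]addrC.
  by split=> u; rewrite /xsection /= !inE/= E.
by rewrite ge0_integralZl//; exact: measurable_fun_xsection.
Qed.

(** For fixed last coordinates [u], only the first coordinate changes, and it does so affinely with
    slope [a]. The measure is therefore sliced in the other order, which [swap] permits. *)
Lemma scales_lebesgue_lower n (a d : R) (w : 'cV[R]_n) : a != 0 ->
  scales_lebesgue
    (fun x : 'rV[R]_n.+1 => x *m (block_mx a%:M 0 w 1%:M : 'M[R]_(1 + n)) +
                            row_mx d%:M 0) `|a|^-1.
Proof.
move=> a0; split; [by rewrite invr_ge0|exact: measurable_affine|].
move=> A mA; have mA' := measurable_cons_preimage mA.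
have mP : measurable (@cons_rV R n @^-1`
    ((fun x : 'rV[R]_n.+1 => x *m (block_mx a%:M 0 w 1%:M : 'M[R]_(1 + n)) +
                            row_mx d%:M 0) @^-1` A)).
  apply: measurable_cons_preimage.
  by rewrite -[X in measurable X]setTI; exact: measurable_affine.
rewrite !lebesgue_rVS /=.
have swap X : measurable X -> (@lebesgue_measure R \x lebesgue_rV R n)%E X =
    (@lebesgue_measure R \x^ lebesgue_rV R n)%E X.
  apply: product_measure_unique => //= B C mB mC.
  exact: product_measure2E.
rewrite !swap // /product_measure2.
transitivity (\int[lebesgue_rV R n]_u
   (`|a|^-1%:E * (@lebesgue_measure R \o ysection (@cons_rV R n @^-1` A)) u))%E.
  apply: eq_integral => u _ /=.
  rewrite -(@lebesgue_measure_affine _ _ ((u *m w) 0 0 + d))//; last first.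
    exact: measurable_ysection.
  congr (lebesgue_measure _); apply/seteqP.
  have E t : (cons_rV (t, u) : 'rV[R]_(1 + n)) *m block_mx a%:M 0 w 1%:M +
      row_mx d%:M 0 = cons_rV (a * t + ((u *m w) 0 0 + d), u).
    rewrite /cons_rV /= mul_row_block add_row_mx mulmx1 mulmx0 add0r addr0.
    congr row_mx; rewrite mul_mx_scalar scale_scalar_mx.
    by rewrite [in LHS](mx11_scalar (u *m w)) -!raddfD/= addrA.
  by split=> t; rewrite /ysection /= !inE/= E.
by rewrite ge0_integralZl// ?lee_fin ?invr_ge0//; exact: measurable_fun_ysection.
Qed.

(** Gaussian elimination by induction on the dimension. With a nonzero pivot, [M] is a lower times
    an upper block triangular matrix; a zero pivot is first repaired by a row operation of
    determinant 1. *)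
Theorem scales_lebesgue_affine n (M : 'M[R]_n) (v : 'rV[R]_n) :
  M \in unitmx -> scales_lebesgue (fun x => x *m M + v) `|\det M|^-1.
Proof.
elim: n M v => [M v _|n IHn M v uM].
  rewrite det_mx00 normr1 invr1; split => //; first exact: measurable_affine.
  move=> A mA; rewrite mul1e; congr (lebesgue_rV R 0 _); apply/seteqP.
  by split=> x /=; rewrite [x]thinmx0 [_ + v]thinmx0.
have upper (b : 'rV[R]_n) (N : 'M[R]_n) v' : N \in unitmx -> scales_lebesgue
    (fun x : 'rV[R]_n.+1 => x *m (block_mx 1%:M b 0 N : 'M[R]_(1 + n)) +
      row_mx 0 v') `|\det N|^-1.
  by move=> uN; apply: scales_lebesgue_upper => w; exact: IHn.
have pivot (M' : 'M[R]_(1 + n)) (v' : 'rV[R]_(1 + n)) : M' \in unitmx ->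
    ulsubmx M' 0 0 != 0 ->
    scales_lebesgue (fun x : 'rV[R]_n.+1 => x *m M' + v') `|\det M'|^-1.
  move=> uM' a0; set a := ulsubmx M' 0 0 in a0.
  pose b := ursubmx M'; pose w := dlsubmx M'; pose N := drsubmx M'.
  (* The Schur complement of the pivot. *)
  pose N' := N - a^-1 *: (w *m b).
  have M'E : M' = block_mx a%:M 0 w 1%:M *m block_mx 1%:M (a^-1 *: b) 0 N'.
    rewrite mulmx_block !mulmx1 !mul1mx !mulmx0 !mul0mx !addr0 -[LHS]submxK.
    congr block_mx => //; first by rewrite [LHS]mx11_scalar.
      by rewrite mul_scalar_mx scalerA mulfV// scale1r.
    by rewrite -scalemxAr /N' addrC subrK.
  have detM' : \det M' = a * \det N'.
    by rewrite M'E det_mulmx det_lblock det_ublock !det_scalar1 !det1 mulr1 mul1r.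
  have uN' : N' \in unitmx.
    by move: uM'; rewrite !unitmxE detM' unitrM => /andP[].
  pose d := lsubmx v' 0 0.
  (* The second map shears the shift [d] of the first coordinate into the others, adding
     [(d / a) *: b]; its own translation compensates for this. *)
  have := scales_lebesgue_comp (scales_lebesgue_lower d w a0)
    (upper (a^-1 *: b) N' (rsubmx v' - (d * a^-1) *: b) uN').
  rewrite detM' normrM invfM; congr (scales_lebesgue _ _).
  apply/funext => x /=.
  rewrite mulmxDl -mulmxA -M'E -addrA; congr (_ + _).
  rewrite (mul_row_block d%:M 0 1%:M _ 0 N') !mulmx0 !mul0mx !addr0 mulmx1.
  rewrite (add_row_mx d%:M _ 0) addr0 mul_scalar_mx scalerA addrC subrK.
  by rewrite /d -mx11_scalar; exact: (@hsubmxK _ 1 1 n v').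
pose M0 : 'M[R]_(1 + n) := M; rewrite -/M0 in uM *.
have [a0|] := eqVneq (ulsubmx M0 0 0) 0; last exact: pivot.
(* By invertibility the first column has a nonzero entry below the pivot; adding its row to the
   first row (left multiplication by [E]) makes the pivot nonzero. *)
have [i wi] : exists i, dlsubmx M0 i 0 != 0.
  apply/existsP; rewrite -[X in is_true X]negbK; apply/negP => /existsPn w0.
  have : \det M0 = 0.
    rewrite -(submxK M0) (_ : ulsubmx _ = 0); last first.
      by rewrite [LHS]mx11_scalar a0 raddf0.
    rewrite (_ : dlsubmx _ = 0); last first.
      apply/matrixP => k j; rewrite ord1 [RHS]mxE; apply/eqP.
      by have := w0 k; rewrite negbK.
    by rewrite det_ublock det0 mul0r.
  by move: uM; rewrite unitmxE => /[swap] ->; rewrite unitr0.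
pose e : 'rV[R]_n := delta_mx 0 i.
pose E : 'M[R]_(1 + n) := block_mx 1%:M e 0 1%:M.
pose E' : 'M[R]_(1 + n) := block_mx 1%:M (- e) 0 1%:M.
have E'E : E' *m E = 1%:M.
  by rewrite mulmx_block !mulmx1 !mul1mx !mulmx0 !mul0mx !addr0 add0r addrN
    -scalar_mx_block.
have dE : \det E = 1 by rewrite det_ublock !det1 mulr1.
have uEM : E *m M0 \in unitmx by rewrite unitmxE det_mulmx dE mul1r -unitmxE.
have EM0 : ulsubmx (E *m M0) 0 0 != 0.
  rewrite -(submxK M0) mulmx_block block_mxKul mul1mx mxE a0 add0r.
  by rewrite -rowE mxE.
have := scales_lebesgue_comp (upper (- e) 1%:M 0 (unitmx1 _ _))
  (pivot _ v uEM EM0).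
rewrite det1 normr1 invr1 mul1r det_mulmx dE mul1r; congr (scales_lebesgue _ _).
apply/funext => x /=.
by rewrite row_mx0 addr0 -mulmxA [X in x *m X]mulmxA E'E mul1mx.
Qed.

End lebesgue_rV_affine.

(** * Euclidean structure and measurability *)

Lemma continuous_sum (R : realType) (V : normedModType R) (T : topologicalType)
    (I : Type) (s : seq I) (f : I -> T -> V) :
  (forall i, continuous (f i)) -> continuous (fun x => \sum_(i <- s) f i x).
Proof.
move=> cf; elim: s => [|i s IHs] x.
  by rewrite (_ : (fun _ => _) = cst 0); [exact: cst_continuous|
    apply/funext => y; rewrite big_nil].
rewrite (_ : (fun _ => _) = (fun y => f i y + \sum_(j <- s) f j y)).
  by apply: cvgD; [exact: cf|exact: IHs].
by apply/funext => y; rewrite big_cons.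
Qed.

Section euclidean.
Context {R : realType} {n : nat}.
Implicit Types (x y z : 'rV[R]_n) (A K : set 'rV[R]_n).

Lemma dotmulC x y : dotmul x y = dotmul y x.
Proof. by apply: eq_bigr => i _; rewrite mulrC. Qed.

Lemma dotmulDl x y z : dotmul (x + y) z = dotmul x z + dotmul y z.
Proof. by rewrite -big_split; apply: eq_bigr => i _; rewrite mxE mulrDl. Qed.

Lemma dotmulZl a x y : dotmul (a *: x) y = a * dotmul x y.
Proof. by rewrite mulr_sumr; apply: eq_bigr => i _; rewrite mxE mulrA. Qed.

Lemma dotmulDr x y z : dotmul z (x + y) = dotmul z x + dotmul z y.
Proof. by rewrite !(dotmulC z) dotmulDl. Qed.

Lemma dotmulZr a x y : dotmul x (a *: y) = a * dotmul x y.
Proof. by rewrite !(dotmulC x) dotmulZl. Qed.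

Lemma dotmulNl x y : dotmul (- x) y = - dotmul x y.
Proof. by rewrite -scaleN1r dotmulZl mulN1r. Qed.

Lemma dotmulNr x y : dotmul x (- y) = - dotmul x y.
Proof. by rewrite dotmulC dotmulNl dotmulC. Qed.

Lemma dotmul0l x : dotmul 0 x = 0.
Proof. by rewrite -(scale0r 0) dotmulZl mul0r. Qed.

Definition dotmulE :=
  (dotmulDl, dotmulDr, dotmulNl, dotmulNr, dotmulZl, dotmulZr).

Lemma dotmul_ge0 x : 0 <= dotmul x x.
Proof. by apply: sumr_ge0 => i _; rewrite -expr2 sqr_ge0. Qed.

Lemma sqr_norm2 x : norm2 x ^+ 2 = dotmul x x.
Proof. by rewrite sqr_sqrtr ?dotmul_ge0. Qed.

Lemma norm2_ge0 x : 0 <= norm2 x. Proof. exact: sqrtr_ge0. Qed.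

Lemma norm2Z a x : norm2 (a *: x) = `|a| * norm2 x.
Proof.
by rewrite /norm2 !dotmulE mulrA -expr2 sqrtrM ?sqr_ge0// sqrtr_sqr.
Qed.

Lemma norm2N x : norm2 (- x) = norm2 x.
Proof. by rewrite -scaleN1r norm2Z normrN1 mul1r. Qed.

Lemma coord_sqr_le_dotmul x i : x ord0 i ^+ 2 <= dotmul x x.
Proof.
rewrite /dotmul (bigD1 i)//= -expr2 lerDl; apply: sumr_ge0 => j _.
by rewrite -expr2 sqr_ge0.
Qed.

Lemma norm2_eq0 x : norm2 x = 0 -> x = 0.
Proof.
move=> x0; apply/rowP => i; rewrite mxE; apply/eqP; rewrite -sqrf_eq0 eq_le.
by rewrite sqr_ge0 andbT (le_trans (coord_sqr_le_dotmul x i))// -sqr_norm2 x0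
  expr0n.
Qed.

Lemma coord_le_norm2 x i : `|x ord0 i| <= norm2 x.
Proof.
by rewrite -(@ler_pXn2r _ 2)// ?nnegrE ?norm2_ge0// sqr_norm2 real_normK
  ?num_real// coord_sqr_le_dotmul.
Qed.

(** Cauchy-Schwarz: for nonzero vectors, expand the square of [norm2 y *: x - norm2 x *: y]. *)
Lemma dotmul_le x y : dotmul x y <= norm2 x * norm2 y.
Proof.
have [/eqP x0|x0] := boolP (norm2 x == 0).
  by rewrite x0 mul0r (norm2_eq0 x0) dotmul0l.
have [/eqP y0|y0] := boolP (norm2 y == 0).
  by rewrite y0 mulr0 (norm2_eq0 y0) dotmulC dotmul0l.
have xp : 0 < norm2 x by rewrite lt_neqAle eq_sym x0 norm2_ge0.
have yp : 0 < norm2 y by rewrite lt_neqAle eq_sym y0 norm2_ge0.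
have := dotmul_ge0 (norm2 y *: x - norm2 x *: y).
rewrite !dotmulE -!sqr_norm2 (dotmulC y x) => h.
rewrite -subr_ge0 -(@pmulr_rge0 _ (2 * norm2 x * norm2 y)).
  by apply: le_trans h _; rewrite le_eqVlt; apply/orP; left; apply/eqP; ring.
by rewrite !mulr_gt0.
Qed.

Lemma ler_norm2D x y : norm2 (x + y) <= norm2 x + norm2 y.
Proof.
rewrite -(@ler_pXn2r _ 2)// ?nnegrE ?addr_ge0 ?norm2_ge0//.
rewrite sqr_norm2 !dotmulE -!sqr_norm2 (dotmulC y x).
have := dotmul_le x y; nra.
Qed.

Lemma ler_norm2B x y : norm2 (x - y) <= norm2 x + norm2 y.
Proof. by rewrite (le_trans (ler_norm2D _ _))// norm2N. Qed.

Lemma dotmul_continuous y : continuous (fun x => dotmul x y).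
Proof.
apply: continuous_sum => i x.
by apply: continuousM; [exact: coord_continuous|exact: cst_continuous].
Qed.

Lemma sqr_norm2_continuous : continuous (fun x => dotmul x x).
Proof.
apply: continuous_sum => i x.
by apply: continuousM; exact: coord_continuous.
Qed.

Lemma norm2_continuous : continuous (@norm2 R n).
Proof.
move=> x; apply: continuous_comp; first exact: sqr_norm2_continuous.
exact: sqrt_continuous.
Qed.

Lemma measurable_dotmul y : measurable_fun setT (fun x => dotmul x y).
Proof.
apply: measurable_sum => i; apply: measurable_funM => //.
exact: measurable_coord_rV.
Qed.

Lemma measurable_sqr_norm2 : measurable_fun setT (fun x => dotmul x x).
Proof.
by apply: measurable_sum => i; apply: measurable_funM;
  exact: measurable_coord_rV.
Qed.

(** An open set is the union of the countably many cubes inside it with rational centre and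
    half-side [1/(k+1)]. *)
Lemma open_measurable_rV A : open A -> measurable A.
Proof.
move=> oA.
pose box (p : 'rV[rat]_n * nat) := [set x : 'rV[R]_n |
  forall i, ball (ratr (p.1 ord0 i) : R) p.2.+1%:R^-1 (x ord0 i)].
pose F p := if `[< box p `<=` A >] then box p else set0.
rewrite (_ : A = \bigcup_p F p).
  apply: countable_bigcupT_measurable; first exact: countableP.
  move=> p; rewrite /F; case: ifP => // _.
  apply: (measurable_box
    (A := fun i => ball (ratr (p.1 ord0 i) : R) p.2.+1%:R^-1)) => i.
  exact: measurable_ball.
apply/seteqP; split => [x Ax|x [p _]]; last first.
  by rewrite /F; case: ifP => [/asboolP pA|//]; exact: pA.
have := oA; rewrite openE => /(_ x Ax) /nbhs_ballP[e /= e0 eA].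
have [k ke] : exists k : nat, k.+1%:R^-1 < e / 2.
  exists (Num.trunc (e / 2)^-1).
  rewrite invf_plt ?posrE ?divr_gt0//.
  by rewrite truncnS_gt.
have /choice[q qP] : forall i, exists q : rat,
    `|x ord0 i - ratr q| < k.+1%:R^-1.
  move=> i; have /rat_in_itvoo[q] : x ord0 i - k.+1%:R^-1 < x ord0 i.
    by rewrite ltrBlDr ltrDl invr_gt0.
  rewrite in_itv /= => /andP[h1 h2]; exists q.
  by rewrite ger0_norm ?subr_ge0 ?ltW// ltrBlDr addrC -ltrBlDr.
exists (\row_i q i, k) => //; rewrite /F ifT.
  by move=> i /=; rewrite mxE /ball /= distrC.
apply/asboolP => y yb; apply: eA.
rewrite mx_norm_ball /ball_ /= [X in X < _]mx_normrE.
apply: bigmax_lt => //= -[a i] _; rewrite !mxE ord1 /=.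
have := qP i; have := yb i; rewrite /= mxE /ball /= => h1 h2.
rewrite (_ : _ - _ = (x ord0 i - ratr (q i)) + (ratr (q i) - y ord0 i)); last by ring.
by rewrite (le_lt_trans (ler_normD _ _))// (splitr e) ltrD// (lt_trans _ ke).
Qed.

Lemma closed_measurable_rV A : closed A -> measurable A.
Proof.
by move=> /closed_openC /open_measurable_rV /measurableC; rewrite setCK.
Qed.

Lemma compact_measurable_rV A : compact A -> measurable A.
Proof.
by move=> cA; apply: closed_measurable_rV; apply: compact_closed => //;
  exact: norm_hausdorff.
Qed.

End euclidean.

(** * Packing *)

Section measure_tools.
Context {R : realType} {n : nat}.
Local Notation mu := (lebesgue_rV R n).
Implicit Types (x y z v : 'rV[R]_n) (A K : set 'rV[R]_n).

Lemma lebesgue_rV_bounded A M : measurable A ->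
  (forall x, A x -> forall i, `|x ord0 i| <= M) -> (mu A < +oo)%E.
Proof.
move=> mA AM.
have mbox (i : 'I_n) : measurable [set` `[- M, M]] by exact: measurable_itv.
apply: (@le_lt_trans _ _
    (mu [set x | forall i : 'I_n, [set` `[- M, M]] (x ord0 i)])).
  apply: le_measure; rewrite ?inE//; first exact: (measurable_box
      (A := fun=> [set` `[- M, M]])).
  by move=> x Ax i /=; rewrite in_itv /= -ler_norml; exact: AM.
rewrite (lebesgue_rV_box (A := fun=> [set` `[- M, M]]))//.
rewrite (eq_bigr (fun _ => (if - M < M then M - - M else 0)%:E)).
  by rewrite prodEFin ltry.
by move=> i _; rewrite lebesgue_measure_itv /= lte_fin; case: ifP.
Qed.

Lemma ge0_integral_affine (M : 'M[R]_n) v D (f : 'rV[R]_n -> \bar R) :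
  M \in unitmx -> measurable D -> measurable_fun D f -> (forall x, 0 <= f x)%E ->
  (\int[mu]_(x in (fun x => x *m M + v)%R @^-1` D) f (x *m M + v)%R =
   `|\det M|^-1%:E * \int[mu]_(x in D) f x)%E.
Proof.
move=> uM mD mf f0; have [c0 mphi phiE] := scales_lebesgue_affine v uM.
rewrite -(ge0_integral_pushforward mphi mu mD mf (fun y _ => f0 y)).
rewrite -[RHS](ge0_integral_mscale mu mD (NngNum c0) mf (fun y _ => f0 y)).
apply: eq_measure_integral => /= A mA _.
exact: phiE.
Qed.

(** The image is rewritten as a preimage under the inverse homothety, which gives both its
    measurability and its measure. *)
Lemma lebesgue_rV_homothety A (c : R) v : c != 0 -> measurable A ->
  measurable [set c *: x + v | x in A] /\
  mu [set c *: x + v | x in A] = ((`|c| ^+ n)%:E * mu A)%E.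
Proof.
move=> c0 mA.
have ucM : (c^-1%:M : 'M[R]_n) \in unitmx.
  by rewrite unitmxE det_scalar unitrX// unitfE invr_eq0.
have [_ mphi phiE] := scales_lebesgue_affine (- (c^-1 *: v)) ucM.
have -> : [set c *: x + v | x in A] =
    (fun x => x *m c^-1%:M - c^-1 *: v) @^-1` A.
  apply/seteqP; split=> [_ [x Ax <-]|x Ax] /=.
    by rewrite mul_mx_scalar scalerDr scalerA mulVf// scale1r addrK.
  exists (x *m c^-1%:M - c^-1 *: v) => //.
  by rewrite mul_mx_scalar scalerBr !scalerA mulfV// !scale1r subrK.
split; first by rewrite -[X in measurable X]setTI; exact: mphi.
by rewrite phiE// det_scalar normrX normfV exprVn invrK.
Qed.

End measure_tools.

(** Additivity over disjoint pieces. The density [f] is general because it is constant for the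
    entropy bound and Gaussian for the covering by polars. *)
Lemma packing_le_integral d (T : measurableType d) (R : realType)
    (mu : {measure set T -> \bar R}) (I : eqType) (s : seq I) (F : I -> set T)
    (S : set T) (f : T -> \bar R) (m : R) :
  measurable S -> (forall i, measurable (F i)) -> uniq s ->
  trivIset [set` s] F -> (forall i, i \in s -> F i `<=` S) ->
  measurable_fun setT f -> (forall x, 0 <= f x)%E ->
  (forall i, i \in s -> m%:E <= \int[mu]_(x in F i) f x)%E ->
  (((size s)%:R * m)%:E <= \int[mu]_(x in S) f x)%E.
Proof.
move=> mS mF us tF FS mf f0 mle.
have mfS A : measurable_fun A f by apply: measurable_funS mf.
apply: (@le_trans _ _ (\int[mu]_(x in \big[setU/set0]_(i <- s) F i) f x)%E).
  rewrite ge0_integral_bigsetU// (@le_trans _ _ (\sum_(i <- s) m%:E)%E)//.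
    by rewrite sumEFin big_const_seq count_predT iter_addr_0 mulr_natl.
  by rewrite big_seq [leRHS]big_seq; exact: lee_sum.
apply: ge0_subset_integral => //; first exact: bigsetU_measurable.
rewrite big_seq; elim/big_ind: _ => // A B AS BS.
by rewrite subUset.
Qed.

Definition separated (T : eqType) (r : T -> T -> Prop) (s : seq T) :=
  uniq s /\ {in s &, forall x y, x != y -> r x y}.

(** Greedy choice: if every separated list could be extended, one of length [N + 1] would arise. The
    case [x = y] is there because [r] is not assumed irreflexive. *)
Lemma maximal_separated (T : eqType) (r : T -> T -> Prop) (P : set T) (N : nat) :
  (forall x y, r x y -> r y x) ->
  (forall s, separated r s -> {in s, forall x, P x} -> (size s <= N)%N) ->
  exists s, [/\ separated r s, {in s, forall x, P x} &
    forall x, P x -> exists2 y, y \in s & x = y \/ ~ r x y].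
Proof.
move=> rC sN; apply: contrapT => nomax.
suff [s [ss sP sz]] : exists s, [/\ separated r s, {in s, forall x, P x} &
    size s = N.+1].
  by have := sN _ ss sP; rewrite sz ltnn.
elim: N.+1 => [|k [s [ss sP sz]]]; first by exists [::].
apply: contrapT => nok; apply: nomax; exists s; split => // x Px.
apply: contrapT => nx; apply: nok; exists (x :: s).
have xs y : y \in s -> x != y /\ r x y.
  move=> ys; split; last by apply: contrapT => nr; apply: nx; exists y => //; right.
  by apply/eqP => xy; apply: nx; exists y => //; left.
case: ss => us ss; split.
- split; first by rewrite /= us andbT; apply/negP => /xs[]; rewrite eqxx.
  move=> y z; rewrite !inE => /predU1P[->|ys] /predU1P[->|zs] yz.
  + by rewrite eqxx in yz.
  + exact: (xs _ zs).2.
  + exact/rC/(xs _ ys).2.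
  + exact: ss.
- by move=> y; rewrite inE => /predU1P[->//|/sP].
- by rewrite /= sz.
Qed.

(** * The Gaussian measure *)

Lemma ge0_integral_rVS (R : realType) n (f : 'rV[R]_n.+1 -> \bar R) :
  measurable_fun setT f -> (forall x, 0 <= f x)%E ->
  (\int[lebesgue_rV R n.+1]_x f x =
   \int[@lebesgue_measure R]_a \int[lebesgue_rV R n]_u f (cons_rV (a, u)))%E.
Proof.
move=> mf f0.
transitivity (\int[@lebesgue_measure R \x lebesgue_rV R n]_p
    (f \o @cons_rV R n) p)%E.
  have mcons : measurable_fun [set: measurableTypeR R * 'rV[R]_n] (@cons_rV R n).
    exact: measurable_cons_rV.
  have := ge0_integral_pushforward mcons (@lebesgue_measure R \x lebesgue_rV R n)%E
    measurableT mf (fun y _ => f0 y).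
  by rewrite preimage_setT => <-.
rewrite fubini_tonelli1// => [|x]; last exact: f0.
by apply: measurableT_comp => //; exact: measurable_cons_rV.
Qed.

Section gauss.
Context {R : realType}.
Local Open Scope ereal_scope.
Implicit Types n : nat.

(** Left unnormalised: masses are only compared with the total mass, which is finite and positive.
    On the line this is [gauss_fun]. *)
Definition gauss_density n (x : 'rV[R]_n) : R := expR (- dotmul x x).

Lemma measurable_gauss_density n : measurable_fun setT (@gauss_density n).
Proof.
apply: measurableT_comp; first exact: measurable_expR.
by apply: measurable_funN; exact: measurable_sqr_norm2.
Qed.

Lemma gauss_density_ge0 n (x : 'rV[R]_n) : (0 <= gauss_density x)%R.
Proof. exact: expR_ge0. Qed.

Lemma gauss_density_EFin_ge0 n (x : 'rV[R]_n) : 0 <= (gauss_density x)%:E.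
Proof. by rewrite lee_fin gauss_density_ge0. Qed.

Definition gauss_mass n (A : set 'rV[R]_n) : \bar R :=
  \int[lebesgue_rV R n]_(x in A) (gauss_density x)%:E.

Lemma gauss_mass_ge0 n (A : set 'rV[R]_n) : 0 <= gauss_mass A.
Proof. by apply: integral_ge0 => x _; rewrite lee_fin gauss_density_ge0. Qed.

Lemma gauss_massT_lty n : gauss_mass [set: 'rV[R]_n] < +oo.
Proof.
elim: n => [|n IHn].
  rewrite /gauss_mass (eq_integral (cst 1)); last first.
    move=> x _; rewrite /gauss_density /dotmul big_ord0 oppr0 expR0//.
  by rewrite integral_cst// mul1e /= diracT ltry.
rewrite /gauss_mass ge0_integral_rVS//; last 2 first.
- by apply/measurable_EFinP; exact: measurable_gauss_density.
- by move=> x; rewrite lee_fin gauss_density_ge0.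
rewrite (eq_integral (fun a : measurableTypeR R =>
  gauss_mass [set: 'rV[R]_n] * (gauss_fun a)%:E)).
  rewrite ge0_integralZl//.
  - rewrite integralT_gauss lte_mul_pinfty// ?gauss_mass_ge0//.
    + by rewrite ge0_fin_numE// gauss_mass_ge0.
    + by rewrite ltry.
  - by apply/measurable_EFinP; exact: measurable_gauss_fun.
  - by move=> x _; rewrite lee_fin gauss_fun_ge0.
  - exact: gauss_mass_ge0.
move=> a _; rewrite /gauss_mass muleC -ge0_integralZl//; last first.
- by rewrite lee_fin gauss_fun_ge0.
- by move=> x _; rewrite lee_fin gauss_density_ge0.
- by apply/measurable_EFinP; exact: measurable_gauss_density.
apply: eq_integral => u _; rewrite -EFinM /gauss_fun /gauss_density -expRD.
rewrite /dotmul big_ord_recl cons_rV0 opprD /= expr2.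
by under eq_bigr do rewrite cons_rVS.
Qed.

(** On the unit cube, of volume 1, the density is at least [exp(-n)]. *)
Lemma gauss_massT_gt0 n : 0 < gauss_mass [set: 'rV[R]_n].
Proof.
pose B := [set x : 'rV[R]_n | forall i, [set` `[0%R, 1%R]] (x ord0 i)].
have mB : measurable B.
  by apply: (measurable_box (A := fun=> [set` `[0%R, 1%R]])) => i.
have muB : lebesgue_rV R n B = 1.
  rewrite (lebesgue_rV_box (A := fun=> [set` `[0%R, 1%R]]))// big1// => i _.
  by rewrite lebesgue_measure_itv /= lte_fin ltr01 sube0.
have mg A : measurable_fun A (fun x : 'rV[R]_n => (gauss_density x)%:E).
  by apply: measurable_funTS; apply/measurable_EFinP;
    exact: measurable_gauss_density.
apply: (@lt_le_trans _ _ (\int[lebesgue_rV R n]_(x in B) (expR (- n%:R))%:E)).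
  by rewrite (integral_cst _ mB) [X in _ * X]muB mule1 lte_fin expR_gt0.
apply: (@le_trans _ _ (gauss_mass B)).
  apply: ge0_le_integral => //.
  move=> x Bx; rewrite lee_fin ler_expR lerN2 /dotmul.
  rewrite -[X in (_ <= X%:R)%R]card_ord -sum1_card natr_sum ler_sum// => i _.
  have /= := Bx i; rewrite in_itv /= => /andP[x0 x1].
  by rewrite mulr_ile1.
apply: ge0_subset_integral => //.
by move=> x _; rewrite lee_fin gauss_density_ge0.
Qed.

(** Complete the square: [-|y|^2 + <z,y> = |z|^2/4 - |y - z/2|^2]. *)
Lemma gauss_mgf n (z : 'rV[R]_n) :
  \int[lebesgue_rV R n]_y (gauss_density y * expR (dotmul z y))%:E =
  (expR (dotmul z z / 4))%:E * gauss_mass [set: 'rV[R]_n].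
Proof.
have mg : measurable_fun setT (fun x : 'rV[R]_n => (gauss_density x)%:E).
  by apply/measurable_EFinP; exact: measurable_gauss_density.
have := ge0_integral_affine (- (2^-1 *: z))%R (unitmx1 R n) measurableT mg
  (@gauss_density_EFin_ge0 n).
rewrite preimage_setT det1 normr1 invr1 mul1e /gauss_mass => <-.
have mf := measurableT_comp mg (measurable_affine 1%:M (- (2^-1 *: z))%R).
have c0 : 0 <= (expR (dotmul z z / 4))%:E by rewrite lee_fin expR_ge0.
rewrite -(ge0_integralZl _ measurableT mf
  (fun x _ => gauss_density_EFin_ge0 _) c0).
apply: eq_integral => y _; rewrite -EFinM /gauss_density -!expRD mulmx1.
by congr (expR _)%:E; rewrite !dotmulE (dotmulC y z); field.
Qed.

(** The exponent is [-|y/2|^2], and halving has determinant [2^-n]. *)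
Lemma gauss_half n :
  \int[lebesgue_rV R n]_y (gauss_density y * expR (3 / 4 * dotmul y y))%:E =
  (2 ^+ n)%:E * gauss_mass [set: 'rV[R]_n].
Proof.
have mg : measurable_fun setT (fun x : 'rV[R]_n => (gauss_density x)%:E).
  by apply/measurable_EFinP; exact: measurable_gauss_density.
have u2 : (2^-1%:M : 'M[R]_n) \in unitmx.
  by rewrite unitmxE det_scalar unitrX// unitfE invr_eq0 pnatr_eq0.
have := ge0_integral_affine 0%R u2 measurableT mg
  (@gauss_density_EFin_ge0 n).
rewrite preimage_setT det_scalar normrX ger0_norm ?invr_ge0// exprVn invrK => <-.
apply: eq_integral => y _; rewrite /gauss_density -!expRD.
by rewrite mul_mx_scalar addr0 !dotmulE; congr (expR _)%:E; field.
Qed.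

Lemma gauss_mass_translate n (A : set 'rV[R]_n) v : measurable A ->
  gauss_mass [set (x + v)%R | x in A] =
  \int[lebesgue_rV R n]_(x in A) (gauss_density (x + v))%:E.
Proof.
move=> mA.
have [mB _] := lebesgue_rV_homothety v (oner_neq0 R) mA.
have BE : [set 1 *: x + v | x in A]%R = [set (x + v)%R | x in A].
  by apply: eq_imagel => x _; rewrite scale1r.
rewrite BE in mB.
have mg : measurable_fun [set (x + v)%R | x in A]
    (fun x : 'rV[R]_n => (gauss_density x)%:E).
  by apply: measurable_funTS; apply/measurable_EFinP;
    exact: measurable_gauss_density.
have := ge0_integral_affine v (unitmx1 R n) mB mg
  (@gauss_density_EFin_ge0 n).
rewrite det1 normr1 invr1 mul1e /gauss_mass => <-.
under [in LHS]eq_integral do rewrite mulmx1.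
congr integral; apply/seteqP; split => x /=.
  by rewrite mulmx1 => -[y Ay] /addIr <-.
by move=> Ax; exists x => //; rewrite mulmx1.
Qed.

(* Averaging over [v] and [- v] replaces the factor [exp(-2<x,v>)] by a cosh. *)
Lemma gauss_mass_shift n (A : set 'rV[R]_n) v :
  measurable A -> (forall x, A x -> A (- x)%R) ->
  (expR (- dotmul v v))%:E * gauss_mass A <=
  gauss_mass [set (x + v)%R | x in A].
Proof.
move=> mA sA; rewrite gauss_mass_translate//.
have mg w : measurable_fun A (fun x : 'rV[R]_n => (gauss_density (x + w))%:E).
  apply: measurable_funTS; apply/measurable_EFinP.
  apply: (measurableT_comp (@measurable_gauss_density n)).
  rewrite (_ : (fun x => _) = (fun x => x *m 1%:M + w)%R).
    exact: measurable_affine.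
  by apply/funext => x; rewrite mulmx1.
have uN : (- 1%:M : 'M[R]_n)%R \in unitmx.
  by rewrite -scaleN1r unitmxZ ?unitmx1// unitrN unitr1.
(* Reflecting the symmetric set [A] exchanges the translations by [v] and [- v]. *)
have E : \int[lebesgue_rV R n]_(x in A) (gauss_density (x - v))%:E =
    \int[lebesgue_rV R n]_(x in A) (gauss_density (x + v))%:E.
  have := ge0_integral_affine 0%R uN mA (mg v)
    (fun x => gauss_density_EFin_ge0 (x + v)%R).
  rewrite -scaleN1r detZ det1 mulr1 normrX normrN1 expr1n invr1 mul1e => <-.
  rewrite (_ : _ @^-1` A = A); last first.
    apply/seteqP; split => x /=; rewrite -scalemxAr mulmx1 scaleN1r addr0.
      by move/sA; rewrite opprK.
    exact: sA.
  apply: eq_integral => x _; congr EFin; rewrite /gauss_density.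
  rewrite -scalemxAr mulmx1 scaleN1r addr0; congr expR.
  by rewrite !dotmulE; ring.
suff : (2 * expR (- dotmul v v))%:E * gauss_mass A <=
    2%:E * \int[lebesgue_rV R n]_(x in A) (gauss_density (x + v))%:E.
  by rewrite EFinM -muleA lee_pmul2l// lte_fin.
have g0 w (x : 'rV[R]_n) (_ : A x) :=
  gauss_density_EFin_ge0 (x + w)%R.
have mg0 : measurable_fun A (fun x : 'rV[R]_n => (gauss_density x)%:E).
  by under eq_fun do rewrite -[X in gauss_density X]addr0; exact: mg.
have c0 : 0 <= (2 * expR (- dotmul v v))%:E.
  by rewrite lee_fin; exact: mulr_ge0 (ler0n R 2) (expR_ge0 _).
have -> : 2%:E * \int[lebesgue_rV R n]_(x in A) (gauss_density (x + v))%:E =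
    \int[lebesgue_rV R n]_(x in A)
      ((gauss_density (x + v))%:E + (gauss_density (x - v))%:E).
  rewrite (ge0_integralD _ mA (g0 v) (mg v) (g0 (- v)%R) (mg (- v)%R)).
  by rewrite E -mule2n mule_natl.
rewrite /gauss_mass -(ge0_integralZl _ mA mg0
  (fun x _ => gauss_density_EFin_ge0 x) c0).
apply: (ge0_le_integral _ mA).
- by move=> x _; exact: mule_ge0 c0 (gauss_density_EFin_ge0 x).
- exact: measurable_funeM.
- by apply: emeasurable_funD; exact: mg.
move=> x _; rewrite -EFinM -EFinD lee_fin /gauss_density.
have -> : (- dotmul (x + v) (x + v) =
    (- dotmul v v) + (- dotmul x x) + (- (2 * dotmul x v)))%R.
  by rewrite !dotmulE (dotmulC v x); ring.
have -> : (- dotmul (x - v) (x - v) =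
    (- dotmul v v) + (- dotmul x x) + 2 * dotmul x v)%R.
  by rewrite !dotmulE (dotmulC v x); ring.
rewrite !expRD -mulrDr -mulrA (mulrC 2%R).
apply: ler_wpM2l; first exact: mulr_ge0 (expR_ge0 _) (expR_ge0 _).
(* With [t = exp(2<x,v>)] what remains is [2 <= 1/t + t]. *)
rewrite [X in (_ <= X + _)%R]expRN.
have := expR_gt0 (2 * dotmul x v); move: (expR _) => t t0.
rewrite -subr_ge0 (_ : _ - _ = (t - 1) ^+ 2 / t)%R.
  exact: divr_ge0 (sqr_ge0 _) (ltW t0).
by field; rewrite gt_eqF.
Qed.

End gauss.

(** * Polarity *)

Section convex_duality.
Context {R : realType} {n : nat}.
Implicit Types (x y z p : 'rV[R]_n) (A C E K : set 'rV[R]_n).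

(** Convexity with a plain real coefficient, in place of the interval-typed one of [convex_set]. *)
Definition is_convex A :=
  forall t x y, 0 <= t <= 1 -> A x -> A y -> A (t *: x + (1 - t) *: y).

Lemma convex_set_is_convex A : convex_set A -> is_convex A.
Proof.
move=> cA t x y /andP[t0 t1] Ax Ay.
exact: set_mem (cA x y (Itv01 t0 t1) (mem_set Ax) (mem_set Ay)).
Qed.

Lemma mx_norm_le_norm2 x : `|x| <= norm2 x.
Proof.
rewrite [leLHS]mx_normrE; apply: bigmax_le => [|[i j] _] /=.
  exact: norm2_ge0.
by rewrite (ord1 i) coord_le_norm2.
Qed.

Lemma bounded_norm2_compact A M : closed A -> (forall x, A x -> norm2 x <= M) ->
  compact A.
Proof.
move=> clA AM; apply: bounded_closed_compact => //.
exists M; split; first exact: num_real.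
move=> N MN x Ax; apply: le_trans (mx_norm_le_norm2 x) _.
by rewrite (le_trans (AM _ Ax))// ltW.
Qed.

Lemma compact_norm2_bounded A : compact A ->
  exists2 M, 0 < M & forall x, A x -> norm2 x <= M.
Proof.
move=> cA.
have /ex_strict_bound_gt0[M M0 MA] : bounded_set (@norm2 R n @` A).
  apply/compact_bounded/continuous_compact => //.
  by apply: continuous_subspaceT; exact: norm2_continuous.
exists M => // x Ax; have /= := MA (norm2 x) (imageP _ Ax).
by rewrite ger0_norm ?norm2_ge0// => /ltW.
Qed.

Lemma continuous_norm2B x : continuous (fun y => norm2 (y - x)).
Proof.
move=> y; apply: continuous_comp; last exact: norm2_continuous.
by apply: continuousB; [exact: cvg_id|exact: cst_continuous].
Qed.

Lemma closed_norm2_le x r : closed [set y | norm2 (y - x) <= r].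
Proof.
rewrite (_ : mkset _ = (fun y => norm2 (y - x)) @^-1` [set t | t <= r])//.
apply: closed_comp => [y _|]; last exact: closed_le.
exact: continuous_norm2B.
Qed.

Lemma closed_dotmul_le y r : closed [set x | dotmul x y <= r].
Proof.
rewrite (_ : mkset _ = (fun x => dotmul x y) @^-1` [set t | t <= r])//.
apply: closed_comp => [x _|]; last exact: closed_le.
exact: dotmul_continuous.
Qed.

(** Cutting [C] with a ball around [y] gives a compact set, on which the distance to [y] has a
    minimiser [p]. If the angle at [p] towards some [c] were acute, a small step from [p] to [c]
    would come closer to [y]. *)
Lemma nearest_point C y : closed C -> is_convex C -> C !=set0 ->
  exists2 p, C p & forall c, C c -> dotmul (y - p) (c - p) <= 0.
Proof.
move=> clC cC [c0 Cc0].
pose A := C `&` [set x | norm2 (x - y) <= norm2 (c0 - y)].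
have cA : compact A.
  apply: (@bounded_norm2_compact _ (norm2 (c0 - y) + norm2 y)).
    by apply: closedI => //; exact: closed_norm2_le.
  move=> x [_ /= xy]; rewrite -(subrK y x) (le_trans (ler_norm2D _ _))//.
  by rewrite lerD2r.
have A0 : A !=set0 by exists c0; split => //=.
have cf : {within A, continuous (fun x => norm2 (x - y))}.
  by apply: continuous_subspaceT; exact: continuous_norm2B.
have [p /set_mem[Cp /= pc0] pmin] := EVT_min_rV A0 cA cf.
have pm c : C c -> dotmul (p - y) (p - y) <= dotmul (c - y) (c - y).
  move=> Cc; rewrite -!sqr_norm2 ler_pXn2r ?nnegrE ?norm2_ge0//.
  have [cy|/ltW cy] := leP (norm2 (c - y)) (norm2 (c0 - y)).
    by apply: pmin; apply/mem_set; split.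
  exact: le_trans cy.
exists p => // c Cc; rewrite leNgt; apply/negP.
set a := dotmul _ _ => a0.
have b0 := dotmul_ge0 (c - p); set b := dotmul _ _ in b0.
(* A step of length [t] changes the squared distance by [-2 t a + t^2 b]; for [t = a/(a+b)] one has
   [t b <= a], so the change is at most [- t a < 0]. *)
have t01 : 0 <= a / (a + b) <= 1.
  rewrite divr_ge0 ?addr_ge0 ?(ltW a0)//= ler_pdivrMr ?ltr_wpDr//.
  by rewrite mul1r lerDl.
have := pm _ (cC _ _ _ t01 Cc Cp); set t := a / (a + b) in t01 *.
have -> : t *: c + (1 - t) *: p - y = (p - y) + t *: (c - p).
  by apply/rowP => i; rewrite !mxE; ring.
have expand (u v : 'rV[R]_n) s : dotmul (u + s *: v) (u + s *: v) =
    dotmul u u + 2 * s * dotmul u v + s ^+ 2 * dotmul v v.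
  by rewrite !dotmulE (dotmulC v u); ring.
rewrite expand -/b (_ : dotmul (p - y) (c - p) = - a); last first.
  by rewrite -dotmulNl opprB.
have tab : t * (a + b) = a by rewrite divfK// gt_eqF// ltr_wpDr.
have t0 : 0 < t by rewrite divr_gt0// ltr_wpDr.
have : t * b <= a by rewrite -tab; nra.
nra.
Qed.

Lemma polarS K E : K `<=` E -> polar E `<=` polar K.
Proof. by move=> KE y Ey z /KE /Ey. Qed.

Lemma polar0 K : polar K 0.
Proof. by move=> z _; rewrite dotmulC dotmul0l. Qed.

Lemma polar_closed K : closed (polar K).
Proof.
rewrite (_ : polar K = \bigcap_(z in K) [set y | dotmul y z <= 1]).
  by apply: closed_bigI => z _; exact: closed_dotmul_le.
by apply/seteqP; split => y Ky z Kz /=; rewrite dotmulC; exact: Ky.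
Qed.

Lemma polar_convex K : is_convex (polar K).
Proof.
move=> t x y /andP[t0 t1] Kx Ky z Kz; rewrite !dotmulE.
have := Kx z Kz; have := Ky z Kz; nra.
Qed.

Lemma polar_opp K : (forall x, K x -> K (- x)) ->
  forall y, polar K y -> polar K (- y).
Proof.
by move=> sK y Ky z Kz; rewrite dotmulNr -dotmulNl; exact/Ky/sK.
Qed.

(** A point [z] outside [E] is separated from [E] by a hyperplane orthogonal to [z - p], with [p]
    nearest to [z]; its normal, suitably scaled, lies in the polar and excludes [z] from the
    bipolar. *)
Lemma bipolar_sub E : closed E -> is_convex E -> E 0 ->
  polar (polar E) `<=` E.
Proof.
move=> clE cE E0 z Ez; have [p Ep sep] := nearest_point z clE cE (ex_intro _ 0 E0).
have [->//|zp] := eqVneq z p.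
have w0 : 0 < dotmul (z - p) (z - p).
  rewrite lt_neqAle dotmul_ge0 andbT eq_sym; apply: contra zp => /eqP w0.
  rewrite -subr_eq0; apply/eqP/norm2_eq0/eqP.
  by rewrite -sqrf_eq0 sqr_norm2 w0.
have wp : 0 <= dotmul (z - p) p.
  by have := sep 0 E0; rewrite sub0r dotmulNr oppr_le0.
(* The level halfway between [p] and [z]; it is positive because [0] lies in [E]. *)
pose b := dotmul (z - p) p + dotmul (z - p) (z - p) / 2.
have b0 : 0 < b by rewrite /b; lra.
have Ew : polar E (b^-1 *: (z - p)).
  move=> e Ee; rewrite dotmulZr ler_pdivrMl// mulr1 dotmulC.
  by have := sep e Ee; rewrite dotmulDr dotmulNr /b; lra.
have := Ez _ Ew; rewrite dotmulZl ler_pdivrMl// mulr1 => zb.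
have : dotmul (z - p) z = dotmul (z - p) p + dotmul (z - p) (z - p).
  by rewrite -dotmulDr [p + _]addrC subrK.
by move: zb; rewrite /b; lra.
Qed.

(* The dual of an intersection is a sum: split [y] into its nearest point in
   the polar of [E] and the remainder, which the bipolar theorem bounds. *)
Lemma polar_setI_ball E r : closed E -> is_convex E -> E 0 -> 0 < r ->
  polar (E `&` [set x | norm2 x <= r]) `<=`
  [set a + b | a in polar E & b in [set b | norm2 b <= r^-1]].
Proof.
move=> clE cE E0 r0 y Ey.
have [p Ep sep] := nearest_point y (@polar_closed E) (@polar_convex E)
  (ex_intro (polar E) 0 (@polar0 E)).
exists p => //; exists (y - p); last by rewrite addrC subrK.
set z := y - p in sep *; rewrite /= leNgt; apply/negP => zr.
have z0 : 0 < norm2 z by rewrite (lt_trans _ zr)// invr_gt0.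
have h0 : 0 <= dotmul z p.
  by have := sep 0 (@polar0 E); rewrite sub0r dotmulNr oppr_le0.
have hE c : polar E c -> dotmul z c <= dotmul z p.
  by move=> /sep; rewrite dotmulDr dotmulNr subr_le0.
have zy : dotmul z y = dotmul z p + norm2 z ^+ 2.
  by rewrite sqr_norm2 -dotmulDr [p + _]addrC subrK.
(* The least factor for which [h^-1 *: z] lies in both the bipolar of [E] and the ball of radius
   [r]. Testing [y] against this point contradicts either value of the maximum. *)
pose h := Num.max (dotmul z p) (norm2 z / r).
have hp : 0 < h by rewrite lt_max (divr_gt0 z0 r0) orbT.
have Ez : E (h^-1 *: z).
  apply: bipolar_sub => // c Ec; rewrite dotmulC dotmulZl ler_pdivrMl// mulr1.
  by rewrite (le_trans (hE _ Ec))// le_max lexx.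
have zh : norm2 (h^-1 *: z) <= r.
  rewrite norm2Z gtr0_norm ?invr_gt0// ler_pdivrMl// -ler_pdivrMr//.
  by rewrite le_max lexx orbT.
have := Ey _ (conj Ez zh); rewrite dotmulZl ler_pdivrMl// mulr1 zy le_max.
move: zr; rewrite -(ltr_pM2r z0) -expr2 mulrC => zr.
by move=> /orP[]; nra.
Qed.

End convex_duality.

(** * Entropy estimates for convex bodies *)

Section packing_convex.
Context {R : realType} {n : nat}.
Implicit Types (x y z : 'rV[R]_n) (A S : set 'rV[R]_n).
Local Notation cball r := [set x : 'rV[R]_n | norm2 x <= r].

Lemma compact_lebesgue_lty A : compact A -> (lebesgue_rV R n A < +oo)%E.
Proof.
move=> cA; have [M _ MA] := compact_norm2_bounded cA.
apply: (lebesgue_rV_bounded (M := M)); first exact: compact_measurable_rV.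
by move=> x Ax i; rewrite (le_trans (coord_le_norm2 x i))// MA.
Qed.

Lemma vol_compact A : compact A -> lebesgue_rV R n A = (vol A)%:E.
Proof.
by move=> cA; rewrite fineK// ge0_fin_numE// compact_lebesgue_lty.
Qed.

Lemma vol_ge0 A : 0 <= vol A. Proof. exact: fine_ge0. Qed.

(** Compactness makes the larger volume finite; otherwise [fine] would send it to 0. *)
Lemma le_vol A K : compact K -> measurable A -> A `<=` K -> vol A <= vol K.
Proof.
move=> cK mA AK; have mK := compact_measurable_rV cK.
have muAK : (lebesgue_rV R n A <= lebesgue_rV R n K)%E.
  by apply: le_measure; rewrite ?inE.
have Koo := compact_lebesgue_lty cK.
by apply: fine_le => //; rewrite ge0_fin_numE//; exact: le_lt_trans Koo.
Qed.

Lemma compact_ball r : compact (cball r).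
Proof.
apply: (@bounded_norm2_compact _ _ _ r) => //.
have := @closed_norm2_le R n 0 r.
by rewrite (_ : [set y | _] = cball r)//; apply/seteqP; split => y /=; rewrite subr0.
Qed.

Lemma compact_setI_ball S r : compact S -> compact (S `&` cball r).
Proof.
move=> cS; apply: (subclosed_compact _ cS); last exact: subIsetl.
apply: closedI; (apply: compact_closed; first exact: norm_hausdorff) => //.
exact: compact_ball.
Qed.

(* With [S_r] the part of [S] in the ball of radius [r], the sets
   [(1 - 2/t) S_r + (2/t) x], for [x] in the separated list,
   are pairwise disjoint subsets of [S]. *)
Lemma packing_card S r t (s : seq 'rV[R]_n) : compact S -> is_convex S ->
  0 < vol S -> 3 / 4 * vol S <= vol (S `&` cball r) -> 0 < r -> 4 <= t ->
  separated (fun x y => t * r < norm2 (x - y)) s -> {in s, forall x, S x} ->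
  (size s)%:R * (3 / 4 * (1 - 2 / t) ^+ n) <= 1.
Proof.
move=> cS cvS S0 Sr r0 t4 [us sep] sS.
have t0 : 0 < t by rewrite (lt_le_trans _ t4).
(* Chosen so that [l t r = 2 r]: a common point of two copies would give
   [l |x - y| = (1 - l) |w' - w| < 2 r], against the separation. *)
set l := 2 / t.
have l0 : 0 < l by rewrite divr_gt0.
have l1 : l <= 1 / 2 by rewrite /l ler_pdivrMr//; lra.
have ml : 0 < 1 - l by lra.
pose F x := [set (1 - l) *: w + l *: x | w in S `&` cball r].
have mSr : measurable (S `&` cball r).
  by apply: compact_measurable_rV; exact: compact_setI_ball.
have hom x := lebesgue_rV_homothety (l *: x) (lt0r_neq0 ml) mSr.
have tF : trivIset [set` s] F.
  move=> x y xs ys [_ [[w [_ wr] <-] [w' [_ wr'] ww']]].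
  apply/eqP; apply: contraT => xy; have := sep _ _ xs ys xy.
  have -> : x - y = l^-1 *: ((1 - l) *: (w' - w)).
    have /(congr1 ( *:%R l^-1)) : l *: (x - y) = (1 - l) *: (w' - w).
      by apply/rowP => i; move/rowP/(_ i): ww'; rewrite !mxE; lra.
    by rewrite scalerA mulVf ?gt_eqF// scale1r.
  rewrite !norm2Z !gtr0_norm ?invr_gt0// ltr_pdivlMl//.
  have := le_trans (ler_norm2B w' w) (lerD wr' wr).
  have -> : l * (t * r) = 2 * r by rewrite /l mulrA divfK// gt_eqF.
  by nra.
have := @packing_le_integral _ _ _ (lebesgue_rV R n) _ s F S (cst 1%E)
  ((1 - l) ^+ n * vol (S `&` cball r)) (compact_measurable_rV cS)
  (fun x => (hom x).1) us tF.
rewrite (integral_cst _ (compact_measurable_rV cS)) mul1e => H.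
have {}H : (size s)%:R * ((1 - l) ^+ n * vol (S `&` cball r)) <= vol S.
  rewrite -lee_fin -[leRHS](vol_compact cS).
  apply: H => // [x xs _ [w [Sw _] <-]|x xs].
    have l01 : 0 <= 1 - l <= 1 by lra.
    by have := cvS _ _ _ l01 Sw (sS _ xs); rewrite subKr.
  rewrite (integral_cst _ (hom x).1) mul1e [leRHS](hom x).2 gtr0_norm//.
  by rewrite vol_compact ?EFinM//; exact: compact_setI_ball.
rewrite -(ler_pM2r S0) mul1r (le_trans _ H)//.
have P0 : 0 <= (1 - l) ^+ n by rewrite exprn_ge0 ?ltW.
by have := ler_wpM2l (ler0n R (size s)) (ler_wpM2l P0 Sr); lra.
Qed.

(** Two points farther apart would form a separated list for [t = 7 n]. By Bernoulli
    [(1 - 2/(7n))^n >= 5/7], and [2 * 3/4 * 5/7 > 1] contradicts the packing bound. *)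
Lemma convex_diameter S r x y : (0 < n)%N -> compact S -> is_convex S ->
  0 < vol S -> 3 / 4 * vol S <= vol (S `&` cball r) -> 0 < r ->
  S x -> S y -> norm2 (x - y) <= 7 * n%:R * r.
Proof.
move=> n0 cS cvS S0 Sr r0 Sx Sy; rewrite leNgt; apply/negP => xy.
have n1 : 1 <= n%:R :> R by rewrite ler1n.
have t4 : 4 <= 7 * n%:R :> R by lra.
have neq : x != y.
  apply/negP => /eqP xyE; move: xy; rewrite xyE subrr /norm2 dotmul0l sqrtr0.
  by rewrite ltNge !mulr_ge0// ltW.
have nl : n%:R * (2 / (7 * n%:R)) = 2 / 7 :> R by field; lra.
have : (size [:: x; y])%:R * (3 / 4 * (1 - 2 / (7 * n%:R)) ^+ n) <= 1 :> R.
  apply: (packing_card cS cvS S0 Sr r0 t4).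
    split; first by rewrite /= inE neq.
    move=> a b; rewrite !inE => /orP[]/eqP-> /orP[]/eqP->; rewrite ?eqxx// => _.
    by rewrite -norm2N opprB.
  by move=> a; rewrite !inE => /orP[]/eqP->.
set l := 2 / _ in nl *.
have l0 : 0 <= l by rewrite divr_ge0 ?mulr_ge0.
have l1 : 0 <= 1 - l.
  by rewrite subr_ge0; apply: (@le_trans _ _ (n%:R * l)); [rewrite ler_peMl|lra].
have bern k : 1 - k%:R * l <= (1 - l) ^+ k.
  elim: k => [|k IHk]; first by rewrite mul0r subr0 expr0.
  rewrite exprS -natr1 (le_trans _ (ler_wpM2l l1 IHk))//.
  have : 0 <= k%:R * l * l by rewrite !mulr_ge0.
  lra.
have := bern n; rewrite nl /=; lra.
Qed.

(** A maximal separated list is a net, and the packing bound controls its length. *)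
Lemma convex_net S r t : compact S -> is_convex S ->
  0 < vol S -> 3 / 4 * vol S <= vol (S `&` cball r) -> 0 < r -> 4 <= t ->
  exists2 s : seq 'rV[R]_n, (size s)%:R <= 4 / 3 * expR (4 * n%:R / t) &
    forall x, S x -> exists2 y, y \in s & norm2 (x - y) <= t * r.
Proof.
move=> cS cvS S0 Sr r0 t4; have t0 : 0 < t by rewrite (lt_le_trans _ t4).
have cardE s : separated (fun x y => t * r < norm2 (x - y)) s ->
    {in s, forall x, S x} -> (size s)%:R <= 4 / 3 * expR (4 * n%:R / t).
  move=> ss sS; have := packing_card cS cvS S0 Sr r0 t4 ss sS; set l := 2 / t.
  have l0 : 0 < l by rewrite divr_gt0.
  have l1 : l <= 1 / 2 by rewrite /l ler_pdivrMr//; lra.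
  (* Here [exp(2 l) >= 1 + 2 l], and [(1 - l)(1 + 2 l) >= 1] as [l <= 1/2]. *)
  have h : expR (- (2 * l)) <= 1 - l.
    rewrite expRN -div1r ler_pdivrMr ?expR_gt0//.
    rewrite (@le_trans _ _ ((1 - l) * (1 + 2 * l)))//; first nra.
    by rewrite ler_pM2l ?expR_ge1Dx//; lra.
  have hn : expR (- (4 * n%:R / t)) <= (1 - l) ^+ n.
    have -> : - (4 * n%:R / t) = n%:R * - (2 * l) by rewrite /l; field; lra.
    by rewrite expRM_natl lerXn2r ?nnegrE ?expR_ge0//; lra.
  move: hn; rewrite expRN -div1r ler_pdivrMr ?expR_gt0// => hn H.
  have e0 : 0 < expR (4 * n%:R / t) by exact: expR_gt0.
  have s0 : 0 <= (size s)%:R :> R by [].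
  nra.
have [||s [ss sS sP]] := @maximal_separated _
    (fun x y => t * r < norm2 (x - y)) S (Num.trunc (4 / 3 * expR (4 * n%:R / t))).
- by move=> x y; rewrite -norm2N opprB.
- move=> s ss sS.
  by rewrite truncn_ge_nat ?cardE// mulr_ge0// expR_ge0.
exists s; first exact: cardE.
move=> x /sP[y ys xy]; exists y => //; case: xy => [->|/negP]; last by rewrite -leNgt.
by rewrite subrr /norm2 dotmul0l sqrtr0 mulr_ge0// ltW.
Qed.

End packing_convex.

(** * Gaussian mass of polars *)

Lemma expR1_ge2 (R : realType) : 2 <= expR 1 :> R.
Proof. by have := expR_ge1Dx (1 : R); lra. Qed.

Section gauss_duality.
Context {R : realType} {n : nat}.
Implicit Types (x y z : 'rV[R]_n) (A E : set 'rV[R]_n).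
Local Notation mu := (lebesgue_rV R n).
Local Notation g := (@gauss_density R n).

Let measurable_g : measurable_fun setT (fun x => (g x)%:E).
Proof. by apply/measurable_EFinP; exact: measurable_gauss_density. Qed.

Let measurable_g_mgf z :
  measurable_fun setT (fun y => (g y * expR (dotmul z y))%:E).
Proof.
apply/measurable_EFinP; apply: measurable_funM.
  exact: measurable_gauss_density.
apply: (measurableT_comp (@measurable_expR R)).
have -> : dotmul z = (fun y => dotmul y z) by apply/funext => y; exact: dotmulC.
exact: measurable_dotmul.
Qed.

Let measurable_g_half :
  measurable_fun setT (fun y => (g y * expR (3 / 4 * dotmul y y))%:E).
Proof.
apply/measurable_EFinP; apply: measurable_funM.
  exact: measurable_gauss_density.
apply: (measurableT_comp (@measurable_expR R)); apply: measurable_funM => //.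
exact: measurable_sqr_norm2.
Qed.

Let g_exp_ge0 y t : 0 <= g y * expR t.
Proof. exact: mulr_ge0 (gauss_density_ge0 y) (expR_ge0 t). Qed.

(** Chernoff bounds. [f1] dominates the density on the slabs and [f2] does so far from the origin;
    each has integral at most a quarter of the total mass. *)
Lemma gauss_tail_slabs (B : set 'rV[R]_n) (s : seq 'rV[R]_n) rho u :
  (0 < n)%N -> measurable B -> 0 < rho -> 0 <= u ->
  {in s, forall z, norm2 z <= rho} ->
  (size s)%:R * expR (- (u ^+ 2 / rho ^+ 2)) <= 1 / 4 ->
  (forall y, B y -> (exists2 z, z \in s & u <= dotmul z y) \/
                    4 * n%:R <= dotmul y y) ->
  ((2%:E * gauss_mass B <= gauss_mass [set: 'rV[R]_n])%E).
Proof.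
move=> n0 mB rho0 u0 srho su BP.
(* The minimiser of [l^2 rho^2 / 4 - l u], the exponent produced by [gauss_mgf]; the minimum is
   [- u^2 / rho^2]. *)
pose l := 2 * u / rho ^+ 2.
have l0 : 0 <= l by rewrite divr_ge0 ?mulr_ge0 ?exprn_ge0 ?(ltW rho0).
pose W := @gauss_mass R n setT.
pose f1 y := \sum_(z <- s) ((expR (- (l * u)))%:E *
   (g y * expR (dotmul (l *: z) y))%:E)%E.
pose f2 y := ((expR (- (3 * n%:R)))%:E *
   (g y * expR (3 / 4 * dotmul y y))%:E)%E.
have m1 z : measurable_fun setT (fun y => (expR (- (l * u)))%:E *
   (g y * expR (dotmul (l *: z) y))%:E)%E by apply: measurable_funeM.
have p1 z y : (0 <= (expR (- (l * u)))%:E *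
   (g y * expR (dotmul (l *: z) y))%:E)%E.
  by rewrite -EFinM lee_fin; exact: mulr_ge0 (expR_ge0 _) (g_exp_ge0 _ _).
have p2 y : (0 <= f2 y)%E 
  by rewrite /f2 -EFinM lee_fin; exact: mulr_ge0 (expR_ge0 _) (g_exp_ge0 _ _).
have mf2 : measurable_fun setT f2 by apply: measurable_funeM.
have mf1 : measurable_fun setT f1 by apply: emeasurable_sum.
have pf1 y : (0 <= f1 y)%E by apply: sume_ge0.
have I1 : (\int[mu]_y f1 y <= (1 / 4)%:E * W)%E.
  rewrite ge0_integral_sum//.
  apply: (@le_trans _ _ (\sum_(z <- s) (expR (- (u ^+ 2 / rho ^+ 2)))%:E * W)%E).
    rewrite big_seq [leRHS]big_seq; apply: lee_sum => z zs.
    rewrite ge0_integralZl//; last first.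
      by move=> y _; rewrite lee_fin; exact: g_exp_ge0.
    rewrite gauss_mgf muleA -EFinM -expRD lee_wpmul2r ?gauss_mass_ge0//.
    rewrite lee_fin ler_expR !dotmulE -sqr_norm2.
    have z2 : norm2 z ^+ 2 <= rho ^+ 2.
      by rewrite ler_pXn2r ?nnegrE ?norm2_ge0 ?(ltW rho0) ?srho.
    have lE : l * rho ^+ 2 = 2 * u by rewrite divfK// gt_eqF// exprn_gt0.
    have -> : u ^+ 2 / rho ^+ 2 = l * u / 2.
      by rewrite /l; field; rewrite gt_eqF.
    have := ler_wpM2l (mulr_ge0 l0 l0) z2.
    have -> : l * l * rho ^+ 2 = 2 * (l * u) by rewrite -mulrA lE; ring.
    lra.
  rewrite -ge0_sume_distrl; last by move=> *; rewrite lee_fin expR_ge0.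
  rewrite lee_wpmul2r ?gauss_mass_ge0// sumEFin big_const_seq count_predT.
  by rewrite iter_addr_0 lee_fin -[leLHS]mulr_natl.
(* The integral is [(2 exp(-3))^n] times the total mass, and [2 exp(-3) <= 1/4] because
   [exp 1 >= 2]. *)
have I2 : (\int[mu]_y f2 y <= (1 / 4)%:E * W)%E.
  rewrite ge0_integralZl//; last first.
    by move=> y _; rewrite lee_fin; exact: g_exp_ge0.
  rewrite gauss_half muleA -EFinM lee_wpmul2r ?gauss_mass_ge0// lee_fin.
  have e2 := @expR1_ge2 R.
  have -> : - (3 * n%:R) = n%:R * (- 3) :> R by ring.
  rewrite expRM_natl -exprMn_comm; last exact: mulrC.
  have q : expR (- 3) * 2 <= 1 / 4 :> R.
    have -> : - 3 = - (1 + 1 + 1) :> R by ring.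
    rewrite expRN !expRD mulrC ler_pdivrMr ?mulr_gt0 ?expR_gt0//.
    by have := expR_gt0 (1 : R); nra.
  rewrite -[leRHS]expr1 (@le_trans _ _ ((1 / 4) ^+ n))//.
    apply: lerXn2r => //; rewrite nnegrE; last by lra.
    exact: mulr_ge0 (expR_ge0 _) (ler0n _ 2).
  by rewrite ler_wiXn2l//; lra.
suff : (gauss_mass B <= \int[mu]_y (f1 y + f2 y))%E.
  rewrite ge0_integralD// => H.
  have {}H := le_trans H (leeD I1 I2).
  have WE : W = (fine W)%:E.
    by rewrite fineK// ge0_fin_numE ?gauss_massT_lty// gauss_mass_ge0.
  move: H; rewrite -/W WE; case: (gauss_mass B) (@gauss_mass_ge0 R n B) => [c _|_|]//=.
  by rewrite -!EFinM -EFinD !lee_fin; lra.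
apply: (@le_trans _ _ (\int[mu]_(y in B) (f1 y + f2 y))%E); last first.
  apply: ge0_subset_integral => //; first exact: emeasurable_funD.
  by move=> y _; rewrite adde_ge0.
apply: ge0_le_integral => //.
- by move=> y _; rewrite lee_fin gauss_density_ge0.
- by apply: measurable_funTS.
- by apply: measurable_funTS; exact: emeasurable_funD.
move=> y By; have [[z zs uz]|y4] := BP _ By.
  apply: (@le_trans _ _ (f1 y)); last by rewrite leeDl.
  rewrite /f1 (perm_big _ (perm_to_rem zs)) big_cons.
  apply: (@le_trans _ _ ((expR (- (l * u)))%:E *
      (g y * expR (dotmul (l *: z) y))%:E)%E); last by rewrite leeDl// sume_ge0.
  rewrite -EFinM lee_fin mulrCA ler_peMr ?gauss_density_ge0// -expRD.
  rewrite -[leLHS]expR0 ler_expR dotmulZl addrC -mulrBr mulr_ge0// subr_ge0//.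
apply: (@le_trans _ _ (f2 y)); last by rewrite leeDr.
rewrite /f2 -EFinM lee_fin mulrCA ler_peMr ?gauss_density_ge0// -expRD.
by rewrite -[leLHS]expR0 ler_expR; lra.
Qed.

(** If [y] violates the constraint at [x] and [|y| < 2 sqrt n], replacing [x] by a net point [z]
    costs at most [2 sqrt n d], so [y] lies in the slab of [z]. The complement is thus covered by
    slabs and the tail, which carry at most half of the mass. *)
Lemma gauss_mass_polar E (s : seq 'rV[R]_n) d rho u :
  (0 < n)%N -> 0 < rho -> 0 <= u -> 0 <= d ->
  (forall x, E x -> exists z, [/\ z \in s, norm2 z <= rho & norm2 (x - z) <= d]) ->
  (size s)%:R * expR (- (u ^+ 2 / rho ^+ 2)) <= 1 / 4 ->
  (gauss_mass [set: 'rV[R]_n] <= 2%:E * gauss_mass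
    [set y | forall x, E x -> (dotmul x y <= u + 2 * Num.sqrt n%:R * d)%R])%E.
Proof.
move=> n0 rho0 u0 d0 net su; set G := [set y | _].
have mG : measurable G.
  apply: closed_measurable_rV.
  rewrite (_ : G = \bigcap_(x in E)
      [set y | dotmul y x <= u + 2 * Num.sqrt n%:R * d]).
    by apply: closed_bigI => z _; exact: closed_dotmul_le.
  by apply/seteqP; split => y Gy x Ex /=; rewrite dotmulC; exact: Gy.
have half : (2%:E * gauss_mass (~` G) <= gauss_mass [set: 'rV[R]_n])%E.
  apply: (@gauss_tail_slabs _ [seq z <- s | norm2 z <= rho] rho u) => //.
  - exact: measurableC.
  - by move=> z; rewrite mem_filter => /andP[].
  - apply: le_trans su; rewrite ler_wpM2r ?expR_ge0// ler_nat.
    by rewrite size_filter count_size.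
  move=> y /existsNP[x /not_implyP[Ex /negP]]; rewrite -ltNge => xy.
  have [y4|y4] := leP (4 * n%:R) (dotmul y y); [by right|left].
  have [z [zs zrho xz]] := net _ Ex.
  exists z; first by rewrite mem_filter zrho.
  have y2 : norm2 y <= 2 * Num.sqrt n%:R.
    rewrite -(@ler_pXn2r _ 2)// ?nnegrE ?norm2_ge0 ?mulr_ge0 ?sqrtr_ge0//.
    by rewrite sqr_norm2 exprMn sqr_sqrtr//; lra.
  have xzy : dotmul (x - z) y <= 2 * Num.sqrt n%:R * d.
    rewrite (le_trans (dotmul_le _ _))// mulrC ler_pM ?norm2_ge0//.
  by move: xzy xy; rewrite dotmulDl dotmulNl; lra.
have split : gauss_mass [set: 'rV[R]_n] = (gauss_mass G + gauss_mass (~` G))%E.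
  rewrite /gauss_mass -(setUv G) ge0_integral_setU//.
  - exact: measurableC.
  - by rewrite setUv.
  - by move=> x _; rewrite lee_fin gauss_density_ge0.
  - by apply/disj_set2P; rewrite setICr.
have fin A : measurable A -> gauss_mass A \is a fin_num.
  move=> mA; rewrite ge0_fin_numE ?gauss_mass_ge0//.
  apply: le_lt_trans (@gauss_massT_lty R n); apply: ge0_subset_integral => //.
  by move=> x _; rewrite lee_fin gauss_density_ge0.
move: half; rewrite split -(fineK (fin _ mG)) -(fineK (fin _ (measurableC mG))).
by rewrite -EFinD -!EFinM !lee_fin; lra.
Qed.

End gauss_duality.

(** * Covering a Euclidean ball by translates of a convex set of large Gaussian mass *)

Section covering.
Context {R : realType} {n : nat}.
Implicit Types (x y z : 'rV[R]_n) (A E : set 'rV[R]_n).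

(** The right-hand side carries [+ 0] to match the form of [lebesgue_rV_homothety]. *)
Lemma polar_scale E a : 0 < a ->
  [set y | forall x, E x -> dotmul x y <= a] = [set a *: w + 0 | w in polar E].
Proof.
move=> a0; apply/seteqP; split => [y Ey|_ [w Ew <-] x Ex].
  exists (a^-1 *: y); last by rewrite addr0 scalerA mulfV ?gt_eqF// scale1r.
  by move=> x Ex; rewrite dotmulZr ler_pdivrMl// mulr1; exact: Ey.
by rewrite addr0 dotmulZr ler_piMr//; [exact: ltW|exact: Ew].
Qed.

(** The dual Sudakov argument. For a list in the ball with no difference in [e A], the translates of
    [a A] by [(2 a / e) x] are disjoint, and by [gauss_mass_shift] each has at least
    [exp(-(2 a sigma / e)^2) / 2] of the total mass. A maximal such list is the covering. *)
Lemma gauss_cover_ball A a sigma e : compact A -> is_convex A ->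
  (forall x, A x -> A (- x)) -> A 0 -> 0 < a -> 0 < e ->
  (gauss_mass [set: 'rV[R]_n] <=
    2%:E * gauss_mass [set (a *: w + 0)%R | w in A])%E ->
  exists2 s : seq 'rV[R]_n,
    (size s)%:R <= 2 * expR (4 * a ^+ 2 * sigma ^+ 2 / e ^+ 2) &
    forall x, norm2 x <= sigma -> exists2 y, y \in s & A (e^-1 *: (x - y)).
Proof.
move=> cA cvA sA A0 a0 e0 half.
have e20 : 0 < e ^+ 2 by rewrite exprn_gt0.
pose aA := [set a *: w + 0 | w in A].
have [maA _] := lebesgue_rV_homothety 0 (lt0r_neq0 a0) (compact_measurable_rV cA).
have saA x : aA x -> aA (- x).
  by move=> [w Aw <-]; exists (- w); [exact: sA|rewrite !addr0 scalerN].
pose W := fine (gauss_mass [set: 'rV[R]_n]).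
have WE : gauss_mass [set: 'rV[R]_n] = W%:E.
  by rewrite fineK// ge0_fin_numE ?gauss_massT_lty// ltW// gauss_massT_gt0.
have W0 : 0 < W by rewrite -lte_fin -WE gauss_massT_gt0.
have cardE s : separated (fun x y => ~ A (e^-1 *: (x - y))) s ->
    {in s, forall x, norm2 x <= sigma} ->
    (size s)%:R <= 2 * expR (4 * a ^+ 2 * sigma ^+ 2 / e ^+ 2).
  move=> [us sep] ss.
  pose F x := [set w + (2 * a / e) *: x | w in aA].
  have mF x : measurable (F x).
    have [+ _] := lebesgue_rV_homothety ((2 * a / e) *: x) (oner_neq0 R) maA.
    rewrite (_ : [set _ | _ in _] = F x)//.
    by apply: eq_imagel => w _; rewrite scale1r.
  have tF : trivIset [set` s] F.
    move=> x y xs ys [_ [[_ [w Aw <-] <-] [_ [w' Aw' <-]]]].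
    rewrite !addr0 => ww'; apply/eqP; apply: contraT => xy.
    case: (sep _ _ xs ys xy).
    (* The factor [2 a / e] makes [(x - y) / e] the midpoint of [w'] and [- w], which lies in [A] by
       symmetry and convexity. *)
    have -> : e^-1 *: (x - y) = 2^-1 *: w' + (1 - 2^-1) *: (- w).
      have /(congr1 ( *:%R (2 * a)^-1)) :
          (2 * a / e) *: (x - y) = a *: w' + a *: (- w).
        by apply/rowP => i; move/rowP/(_ i): ww'; rewrite !mxE; lra.
      rewrite scalerA (_ : (2 * a)^-1 * (2 * a / e) = e^-1); last first.
        by field; rewrite !gt_eqF.
      move=> ->; rewrite scalerDr !scalerA.
      by congr (_ *: _ + _ *: _); field; rewrite gt_eqF.
    apply: cvA => //; last exact: sA.
    by lra.
  have mg : measurable_fun setT (fun x : 'rV[R]_n => (gauss_density x)%:E).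
    by apply/measurable_EFinP; exact: measurable_gauss_density.
  have := @packing_le_integral _ _ _ (lebesgue_rV R n) _ s F setT
    (fun x => (gauss_density x)%:E)
    (expR (- (4 * a ^+ 2 * sigma ^+ 2 / e ^+ 2)) * (W / 2)) measurableT mF us tF.
  rewrite -[X in _ -> _ -> _ -> _ -> (_ <= X)%E]/(gauss_mass setT) WE lee_fin => H.
  have {}H : (size s)%:R *
      (expR (- (4 * a ^+ 2 * sigma ^+ 2 / e ^+ 2)) * (W / 2)) <= W.
    apply: H => // [x|x xs]; first by rewrite lee_fin gauss_density_ge0.
    apply: le_trans (gauss_mass_shift ((2 * a / e) *: x) maA saA).
    rewrite EFinM; apply: lee_pmul.
    - by rewrite lee_fin expR_ge0.
    - by rewrite lee_fin divr_ge0// ltW.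
    - rewrite lee_fin ler_expR lerN2 !dotmulE -sqr_norm2.
      have x2 : norm2 x ^+ 2 <= sigma ^+ 2.
        by rewrite ler_pXn2r ?nnegrE ?norm2_ge0 ?ss// (le_trans (norm2_ge0 x))// ss.
      have := ler_wpM2l (sqr_ge0 (2 * a / e)) x2.
      rewrite (_ : 4 * _ * _ / _ = (2 * a / e) ^+ 2 * sigma ^+ 2).
        by rewrite expr2 mulrA.
      by field; rewrite gt_eqF.
    - move: half; rewrite WE -/aA.
      case: (gauss_mass aA) (@gauss_mass_ge0 R n aA) => [c _|_ _|]//=.
        by rewrite -EFinM !lee_fin; lra.
      by rewrite leey.
  move: H; set q := 4 * _ * _ / _; rewrite expRN.
  have := expR_gt0 q; set E := expR q => E0 H.
  have : (size s)%:R * W <= 2 * E * W.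
    rewrite (_ : _ * W = (size s)%:R * (E^-1 * (W / 2)) * (2 * E)).
      by rewrite [leRHS]mulrC ler_pM2r// mulr_gt0.
    by field; rewrite gt_eqF.
  by rewrite ler_pM2r.
have [||s [ss sS sP]] := @maximal_separated _
    (fun x y => ~ A (e^-1 *: (x - y))) [set x | norm2 x <= sigma]
    (Num.trunc (2 * expR (4 * a ^+ 2 * sigma ^+ 2 / e ^+ 2))).
- by move=> x y + Ayx; apply; rewrite -opprB scalerN; exact: sA.
- by move=> s ss sS; rewrite truncn_ge_nat ?cardE// mulr_ge0// expR_ge0.
exists s; first exact: cardE.
move=> x /sP[y ys xy]; exists y => //; case: xy => [->|/contrapT//].
by rewrite subrr scaler0.
Qed.

(** The ball is covered by few translates [y + e A], hence [B] by as many translates of [A + e A],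
    which is contained in [(1 + e) A]. *)
Lemma vol_sum_ball_le A B a sigma e : compact A -> is_convex A ->
  (forall x, A x -> A (- x)) -> A 0 -> 0 < a -> 0 < e ->
  (gauss_mass [set: 'rV[R]_n] <=
    2%:E * gauss_mass [set (a *: w + 0)%R | w in A])%E ->
  compact B ->
  B `<=` [set x + y | x in A & y in [set y | norm2 y <= sigma]] ->
  vol B <= 2 * expR (4 * a ^+ 2 * sigma ^+ 2 / e ^+ 2) * (1 + e) ^+ n * vol A.
Proof.
move=> cA cvA sA A0 a0 e0 half cB BA.
have [s scard scov] := gauss_cover_ball sigma cA cvA sA A0 a0 e0 half.
have e1 : 0 < 1 + e by rewrite ltr_wpDl.
have mA := compact_measurable_rV cA.
pose F y := [set (1 + e) *: w + y | w in A].
have hom y := lebesgue_rV_homothety y (lt0r_neq0 e1) mA.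
have BF : B `<=` \big[setU/set0]_(y <- s) F y.
  move=> _ /BA [x Ax [b /scov[y ys Ay] <-]].
  rewrite -bigcup_seq; exists y => //=.
  exists ((1 + e)^-1 *: x + (1 - (1 + e)^-1) *: (e^-1 *: (b - y))).
    apply: cvA => //; rewrite invr_ge0 ltW//= invf_le1//.
    by rewrite lerDl ltW.
  rewrite scalerDr !scalerA mulfV ?gt_eqF// scale1r.
  have -> : (1 + e) * (1 - (1 + e)^-1) / e = 1 by field; rewrite !gt_eqF.
  by rewrite scale1r -addrA subrK.
have mB := compact_measurable_rV cB.
have : (lebesgue_rV R n B <= \sum_(y <- s) ((1 + e) ^+ n * vol A)%:E)%E.
  apply: (@le_trans _ _ (lebesgue_rV R n (\big[setU/set0]_(y <- s) F y))).
    apply: le_measure => //; rewrite ?inE//.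
    by apply: bigsetU_measurable => y _; exact: (hom y).1.
  elim: s {scard scov BF} => [|y s IHs]; first by rewrite !big_nil measure0.
  rewrite !big_cons; apply: le_trans (measureU2 _ _ _) _.
  - exact: (hom y).1.
  - by apply: bigsetU_measurable => z _; exact: (hom z).1.
  apply: leeD => //; rewrite [leLHS](hom y).2 gtr0_norm// EFinM.
  by rewrite -vol_compact.
rewrite vol_compact// sumEFin lee_fin big_const_seq count_predT iter_addr_0.
move=> /le_trans; apply; rewrite -[leLHS]mulr_natl -[leRHS]mulrA.
by apply: ler_wpM2r => //; rewrite mulr_ge0 ?vol_ge0 ?exprn_ge0 ?ltW.
Qed.

End covering.

(** * Volume of the polar of a difference body *)

Section difference_body.
Context {R : realType} {n : nat}.
Implicit Types (x y z : 'rV[R]_n) (S E : set 'rV[R]_n).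

Lemma difference_body_compact S : compact S -> compact (difference_body S).
Proof.
move=> cS.
rewrite (_ : difference_body S = (fun p => p.1 - p.2) @` (S `*` S)).
  apply: continuous_compact; last exact: compact_setX.
  apply: continuous_subspaceT => p.
  by apply: continuousB; [exact: cvg_fst|exact: cvg_snd].
apply/seteqP; split => [_ [x Sx [y Sy <-]]|_ [[x y] [Sx Sy] <-]] /=.
  by exists (x, y).
by exists x => //; exists y.
Qed.

Lemma difference_body_convex S : is_convex S -> is_convex (difference_body S).
Proof.
move=> cS t _ _ t01 [x Sx [y Sy <-]] [x' Sx' [y' Sy' <-]].
exists (t *: x + (1 - t) *: x'); first exact: cS.
exists (t *: y + (1 - t) *: y'); first exact: cS.
by apply/rowP => i; rewrite !mxE; ring.
Qed.

Lemma difference_body_opp S x : difference_body S x -> difference_body S (- x).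
Proof. by move=> [a Sa [b Sb <-]]; exists b => //; exists a; rewrite ?opprB. Qed.

Lemma interior_norm2_ball S x : S° x ->
  exists2 eta, 0 < eta & forall y, norm2 y <= eta -> S (x + y).
Proof.
move=> /nbhs_ballP[e /= e0 eS]; exists (e / 2); first by rewrite divr_gt0.
move=> y ye; apply: eS; rewrite mx_norm_ball /ball_ /=.
rewrite opprD addNKr normrN (le_lt_trans (mx_norm_le_norm2 y))//.
by rewrite (le_lt_trans ye)// ltr_pdivrMr// ltr_pMr// ltr1n.
Qed.

Lemma difference_body_ball S : S° !=set0 ->
  exists2 eta, 0 < eta & forall y, norm2 y <= eta -> difference_body S y.
Proof.
move=> [x /interior_norm2_ball[eta eta0 etaS]]; exists eta => // y ye.
exists (x + y); first exact: etaS.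
exists x; last by rewrite addrAC subrr add0r.
by rewrite -(addr0 x); apply: etaS; rewrite /norm2 dotmul0l sqrtr0 ltW.
Qed.

(** Testing [y] against [(eta / |y|) y] bounds its norm by [1 / eta]. *)
Lemma polar_compact E eta : 0 < eta -> (forall y, norm2 y <= eta -> E y) ->
  compact (polar E).
Proof.
move=> eta0 etaE; apply: (@bounded_norm2_compact _ _ _ eta^-1).
  exact: polar_closed.
move=> y Ey; have [->|y0] := eqVneq (norm2 y) 0; first by rewrite invr_ge0 ltW.
have yp : 0 < norm2 y by rewrite lt_neqAle eq_sym y0 norm2_ge0.
have /Ey : E ((eta / norm2 y) *: y).
  by apply: etaE; rewrite norm2Z gtr0_norm ?divr_gt0// divfK.
rewrite dotmulZl -sqr_norm2 expr2 mulrA divfK// => h.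
by rewrite -div1r ler_pdivlMr// mulrC.
Qed.

(** The bound is the volume of the cube inscribed in the ball, with half-side [eta / sqrt n]. *)
Lemma vol_ge_ball E x eta : (0 < n)%N -> 0 < eta -> compact E ->
  (forall y, norm2 y <= eta -> E (x + y)) ->
  (2 * eta / Num.sqrt n%:R) ^+ n <= vol E.
Proof.
move=> n0 eta0 cE etaE; have np : 0 < n%:R :> R by rewrite ltr0n.
have rnp : 0 < Num.sqrt n%:R :> R by rewrite sqrtr_gt0.
pose c := eta / Num.sqrt n%:R; have c0 : 0 < c by rewrite divr_gt0.
pose itv i := [set` `[x ord0 i - c, x ord0 i + c]].
have mB : measurable [set y : 'rV[R]_n | forall i, itv i (y ord0 i)].
  by apply: measurable_box => i; exact: measurable_itv.
have volB : vol [set y : 'rV[R]_n | forall i, itv i (y ord0 i)] =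
    (2 * eta / Num.sqrt n%:R) ^+ n.
  rewrite /vol lebesgue_rV_box; last by move=> i; exact: measurable_itv.
  rewrite (eq_bigr (fun _ => (2 * eta / Num.sqrt n%:R)%:E)) => [|i _].
    by rewrite prodEFin prodr_const card_ord.
  rewrite /itv lebesgue_measure_itv /= lte_fin ifT ?ltrD2l ?gtrN// -EFinD.
  by congr EFin; rewrite /c; ring.
rewrite -volB; apply: le_vol => // y By.
rewrite -(subrK x y) addrC; apply: etaE.
rewrite -(@ler_pXn2r _ 2)// ?nnegrE ?norm2_ge0 ?(ltW eta0)//.
rewrite sqr_norm2 (@le_trans _ _ (\sum_(i < n) c ^+ 2))//.
  apply: ler_sum => i _; rewrite -expr2 -real_normK ?num_real//.
  rewrite ler_pXn2r ?nnegrE ?normr_ge0 ?(ltW c0)//.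
  have := By i; rewrite /itv /= in_itv /= !mxE => /andP[h1 h2].
  by rewrite ler_norml; apply/andP; split; lra.
rewrite sumr_const card_ord -mulr_natl /c expr_div_n sqr_sqrtr ?ler0n//.
by rewrite mulrC divfK// gt_eqF.
Qed.

End difference_body.

(** * Comparison of truncated polars across scales *)

Section reverse_santalo_core.
Context {R : realType} {n : nat}.
Variables (S : set 'rV[R]_n) (r : R).
Hypotheses (n0 : (0 < n)%N) (cS : compact S) (cvS : is_convex S)
  (iS : S° !=set0) (S0 : 0 < vol S)
  (Sr : 3 / 4 * vol S <= vol (S `&` [set x | norm2 x <= r])) (r0 : 0 < r).
Implicit Types x y z : 'rV[R]_n.
Local Notation D := (difference_body S).
Local Notation rn := (Num.sqrt n%:R : R).

(** Radii are counted in units of [r]; [rho = 64^k] gives the set [A_k] of the iteration. *)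
Definition truncated_polar (rho : R) : set 'rV[R]_n :=
  polar (D `&` [set x | norm2 x <= rho * r]).

Let n1 : 1 <= n%:R :> R. Proof. by rewrite ler1n. Qed.

Let D0 : D 0.
Proof.
have [x /interior_subset Sx] := iS.
by exists x => //; exists x; rewrite ?subrr.
Qed.

Let cD : compact D. Proof. exact: difference_body_compact. Qed.

Let clD : closed D.
Proof. by apply: compact_closed; [exact: norm_hausdorff|exact: cD]. Qed.

Let cvD : is_convex D. Proof. exact: difference_body_convex. Qed.

Lemma truncated_polar_compact rho : 0 < rho -> compact (truncated_polar rho).
Proof.
move=> rho0; have [eta eta0 etaD] := difference_body_ball iS.
apply: (@polar_compact _ _ _ (Num.min eta (rho * r))).
  by rewrite lt_min eta0 mulr_gt0.
by move=> y; rewrite le_min => /andP[/etaD ? ?]; split.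
Qed.

(** In the iteration [q = 2^(k+1)]: the truncation radius is [q^6 = 64^(k+1)], the net scale
    [q^4 = 16^(k+1)], and the upper bound on [q^6] says [64^k < 7 n]. Differences of points of a net
    of [S] form a net of the difference body at twice the scale. *)
Lemma truncated_polar_gauss q : 2 <= q -> q ^+ 6 < 448 * n%:R ->
  (gauss_mass [set: 'rV[R]_n] <= 2%:E * gauss_mass
    [set (60 * q ^+ 4 * r * rn) *: w + 0 | w in truncated_polar (q ^+ 6)]%R)%E.
Proof.
move=> q2 qn; have q0 : 0 < q by lra.
have qq : 4 <= q ^+ 2 by rewrite expr2; nra.
have q4 : 16 <= q ^+ 4 by rewrite (exprM q 2 2) expr2; nra.
have q44 : 4 <= q ^+ 4 by lra.
have q46 : q ^+ 4 * 4 <= q ^+ 6 by rewrite (exprD q 4 2) ler_pM2l ?exprn_gt0.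
have rn0 : 0 <= rn by exact: sqrtr_ge0.
have rn2 : rn ^+ 2 = n%:R by rewrite sqr_sqrtr.
have [s0 s0n s0net] := convex_net cS cvS S0 Sr r0 q44.
pose s := [seq x - y | x <- s0, y <- s0].
pose E := D `&` [set x | norm2 x <= q ^+ 6 * r].
have net x : E x -> exists z,
    [/\ z \in s, norm2 z <= 3 * q ^+ 6 * r & norm2 (x - z) <= 2 * q ^+ 4 * r].
  move=> [[a Sa [b Sb <-]] /= abq].
  have [a' sa' aa'] := s0net _ Sa; have [b' sb' bb'] := s0net _ Sb.
  have dist : norm2 (a - b - (a' - b')) <= 2 * q ^+ 4 * r.
    rewrite (_ : a - b - _ = (a - a') - (b - b')); last first.
      by apply/rowP => i; rewrite !mxE; ring.
    by rewrite (le_trans (ler_norm2B _ _))//; lra.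
  exists (a' - b'); split => //; first by apply/allpairsP; exists (a', b').
  rewrite -[a' - b'](subKr (a - b)).
  rewrite (le_trans (ler_norm2B _ _))// (le_trans (lerD abq dist))//.
  by rewrite -mulrDl ler_pM2r//; lra.
(* With [w = n / q^4] the list has at most [16/9 exp(8 w)] entries, and the slab exponent is
   [3136/9 w]. Since [112 w >= 1], the product is at most [16/9 exp(-3) <= 2/9]. *)
have size_s : (size s)%:R *
    expR (- ((56 * q ^+ 4 * r * rn) ^+ 2 / (3 * q ^+ 6 * r) ^+ 2)) <= 1 / 4 :> R.
  rewrite size_allpairs natrM.
  have simp v : (56 * q ^+ 4 * r * v) ^+ 2 / (3 * q ^+ 6 * r) ^+ 2 =
      3136 / 9 * (v ^+ 2 / q ^+ 4) by field; rewrite !gt_eqF.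
  rewrite simp rn2.
  move: s0n; rewrite -(mulrA 4 n%:R); set w := n%:R / q ^+ 4.
  have w3 : 1 <= 112 * w.
    rewrite /w mulrA ler_pdivlMr ?exprn_gt0// mul1r; lra.
  move=> s0n.
  have e0 t : 0 < expR t :> R by exact: expR_gt0.
  apply: (@le_trans _ _ ((4 / 3 * expR (4 * w)) * (4 / 3 * expR (4 * w)) *
      expR (- (3136 / 9 * w)))).
    apply: ler_wpM2r; first exact: ltW.
    by apply: ler_pM.
  rewrite (_ : _ * _ * _ = 16 / 9 * (expR (4 * w) * expR (4 * w) *
    expR (- (3136 / 9 * w)))); last by field.
  rewrite -!expRD (@le_trans _ _ (16 / 9 * expR (- (1 + 1 + 1))))//.
    by rewrite ler_pM2l// ler_expR; lra.
  rewrite expRN !expRD.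
  have e2 := @expR1_ge2 R.
  rewrite -/(_ / _) ler_pdivrMr ?mulr_gt0//.
  have e4 : 4 <= expR 1 * expR 1 :> R by nra.
  nra.
have := gauss_mass_polar n0 _ _ _ net size_s.
have -> : 56 * q ^+ 4 * r * rn + 2 * rn * (2 * q ^+ 4 * r) = 60 * q ^+ 4 * r * rn.
  by ring.
rewrite polar_scale; last by rewrite !mulr_gt0 ?exprn_gt0// sqrtr_gt0; lra.
apply.
- by rewrite !mulr_gt0 ?exprn_gt0.
- by rewrite !mulr_ge0 ?exprn_ge0// ltW.
- by rewrite !mulr_ge0 ?exprn_ge0// ltW.
Qed.

(** By [polar_setI_ball] the larger polar lies in the smaller one plus a ball of radius
    [64 / (q^6 r)], and [vol_sum_ball_le] with [e = 1/q] bounds the cost of adding that ball. *)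
Lemma vol_truncated_polar_step q : 2 <= q -> q ^+ 6 < 448 * n%:R ->
  vol (truncated_polar (q ^+ 6 / 64)) <=
  expR (8000 ^+ 2 * (n%:R / q)) * vol (truncated_polar (q ^+ 6)).
Proof.
move=> q2 qn; have q0 : 0 < q by lra.
have rn2 : rn ^+ 2 = n%:R by rewrite sqr_sqrtr.
have rnp : 0 < rn by rewrite sqrtr_gt0 (lt_le_trans ltr01 n1).
have q1 : 1 <= q by rewrite (le_trans _ q2)// ler1n.
have q60 : 0 < q ^+ 6 by rewrite exprn_gt0.
have q60' : 0 < q ^+ 6 / 64 by rewrite divr_gt0.
pose E := D `&` [set x | norm2 x <= q ^+ 6 * r].
have sub : truncated_polar (q ^+ 6 / 64) `<=`
    [set x + y | x in truncated_polar (q ^+ 6) &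
                 y in [set y | norm2 y <= (q ^+ 6 / 64 * r)^-1]].
  have cE : compact E by exact: compact_setI_ball.
  have clE : closed E by apply: compact_closed; [exact: norm_hausdorff|exact: cE].
  have cvE : is_convex E.
    move=> t x y t01 [Dx /= xq] [Dy /= yq]; split; first exact: cvD.
    rewrite /= (le_trans (ler_norm2D _ _))// !norm2Z.
    have /andP[t0 t1] := t01; rewrite !ger0_norm ?subr_ge0//.
    have t1' : 0 <= 1 - t by rewrite subr_ge0.
    have := ler_wpM2l t0 xq; have := ler_wpM2l t1' yq; lra.
  have E0 : E 0.
    by split => //=; rewrite /norm2 dotmul0l sqrtr0 mulr_ge0 ?ltW.
  move=> y yP; apply: (@polar_setI_ball _ _ E (q ^+ 6 / 64 * r)) => //.
    by rewrite mulr_gt0.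
  apply: polarS yP => x [[Dx _] xq]; split => //.
have cA : compact (truncated_polar (q ^+ 6)) by exact: truncated_polar_compact.
have cB : compact (truncated_polar (q ^+ 6 / 64)) by exact: truncated_polar_compact.
have sA x : truncated_polar (q ^+ 6) x -> truncated_polar (q ^+ 6) (- x).
  apply: polar_opp => z [Dz zq]; split; first exact: difference_body_opp.
  by rewrite /= norm2N.
have a0 : 0 < 60 * q ^+ 4 * r * rn by rewrite !mulr_gt0 ?exprn_gt0.
have qV : 0 < q^-1 by rewrite invr_gt0.
apply: le_trans (vol_sum_ball_le cA (@polar_convex _ _ _) sA (@polar0 _ _ _) a0 qV
  (truncated_polar_gauss q2 qn) cB sub) _.
apply: ler_wpM2r; first exact: vol_ge0.
(* The constant is [7680 = 2 * 60 * 64]. The covering exponent is of order [n / q^2], the dilation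
   costs [n / q], and the factor 2 is absorbed through [1 <= 448 n / q]; the sum stays below
   [8000^2 n / q]. *)
have simp v : 4 * (60 * q ^+ 4 * r * v) ^+ 2 * ((q ^+ 6 / 64 * r)^-1) ^+ 2 /
    q^-1 ^+ 2 = 7680 ^+ 2 * (v ^+ 2 / q ^+ 2) by field; rewrite !gt_eqF.
rewrite simp rn2.
have e1 : (1 + q^-1) ^+ n <= expR (n%:R / q).
  rewrite expRM_natl lerXn2r ?nnegrE ?expR_ge0 ?expR_ge1Dx//.
  by rewrite addr_ge0// ltW.
apply: (@le_trans _ _ (expR 1 * expR (7680 ^+ 2 * (n%:R / q ^+ 2)) * expR (n%:R / q))).
  apply: ler_pM.
  - exact: mulr_ge0 (ler0n R 2) (expR_ge0 _).
  - by apply: exprn_ge0; rewrite addr_ge0// ltW.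
  - by rewrite (ler_pM2r (expR_gt0 _)); exact: expR1_ge2.
  - exact: e1.
rewrite -!expRD ler_expR.
have w0 : 0 <= n%:R / q by rewrite divr_ge0// ltW.
have w2 : n%:R / q ^+ 2 <= n%:R / q.
  rewrite ler_pM2l ?(lt_le_trans ltr01 n1)// lef_pV2 ?posrE ?exprn_gt0//.
  by rewrite expr2 ler_peMl// ltW.
have w1 : 1 <= 448 * (n%:R / q).
  rewrite mulrA ler_pdivlMr// mul1r (le_trans _ (ltW qn))//.
  by rewrite exprS ler_peMr ?(ltW q0)// exprn_ege1.
have := ler_wpM2l (sqr_ge0 (7680 : R)) w2.
lra.
Qed.

(** Step [k] uses [q = 2^(k+1)], and the losses [n / 2^(k+1)] for [k < j] add up to
    [n (1 - 2^-j)]. *)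
Lemma vol_truncated_polar_iter j :
  (forall k, (k < j)%N -> 64 ^+ k < 7 * n%:R :> R) ->
  vol (truncated_polar 1) <=
  expR (8000 ^+ 2 * (n%:R * (1 - 2^-1 ^+ j))) * vol (truncated_polar (64 ^+ j)).
Proof.
elim: j => [_|j IHj jn].
  by rewrite !expr0 subrr !mulr0 expR0 mul1r.
have {}IHj := IHj (fun k kj => jn k (ltnW kj)).
have q6 : (2 ^+ j.+1) ^+ 6 = 64 * 64 ^+ j :> R.
  by rewrite exprAC -exprS; congr (_ ^+ _); ring.
have q2 : 2 <= 2 ^+ j.+1 :> R by rewrite exprS ler_peMr// exprn_ege1// ler1n.
have qn : (2 ^+ j.+1) ^+ 6 < 448 * n%:R :> R.
  by rewrite q6; have := jn j (ltnSn j); lra.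
have := vol_truncated_polar_step q2 qn.
rewrite q6 mulrAC divff ?pnatr_eq0// mul1r -exprS => step.
apply: (le_trans IHj); apply: le_trans (ler_wpM2l (expR_ge0 _) step) _.
rewrite [leLHS]mulrA -expRD -mulrDr -mulrDr.
rewrite (_ : 1 - 2^-1 ^+ j + _ = 1 - 2^-1 ^+ j.+1)//.
by rewrite exprVn !exprS exprVn; field; rewrite expf_neq0 ?pnatr_eq0.
Qed.

(** By Cauchy-Schwarz this polar contains the ball of radius [1 / r]. *)
Lemma vol_truncated_polar1 : (2 / (r * rn)) ^+ n <= vol (truncated_polar 1).
Proof.
rewrite invfM mulrA; apply: (vol_ge_ball (x := 0)) => //.
- by rewrite invr_gt0.
- by apply: truncated_polar_compact; exact: ltr01.
move=> y yr x [_ /=]; rewrite mul1r add0r => xr.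
apply: (le_trans (dotmul_le x y)).
rewrite (le_trans (ler_pM (norm2_ge0 x) (norm2_ge0 y) xr yr))//.
by rewrite mulfV// gt_eqF.
Qed.

Theorem vol_polar_difference_body_ge :
  (2 * expR (- 8000 ^+ 2) / (r * rn)) ^+ n <= vol (polar D).
Proof.
(* The first scale that reaches the diameter bound: there the truncation has no effect, while
   minimality allows every step before it. *)
have [m mP mmin] : exists2 m : nat, 7 * n%:R <= 64 ^+ m :> R &
    forall k, (k < m)%N -> 64 ^+ k < 7 * n%:R :> R.
  have ex : exists m : nat, 7 * n%:R <= 64 ^+ m :> R.
    by exists (7 * n)%N; rewrite -natrM -natrX ler_nat ltnW// ltn_expl.
  by exists (ex_minn ex); case: ex_minnP => // m _ + k km => /(_ k);
    rewrite leqNgt km ltNge => /implyP; rewrite implybF.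
have Dm : polar D = truncated_polar (64 ^+ m).
  congr polar; apply/seteqP; split => [x Dx|x []//]; split => //.
  case: Dx => a Sa [b Sb <-] /=.
  rewrite (le_trans (convex_diameter n0 cS cvS S0 Sr r0 Sa Sb))//.
  by rewrite ler_pM2r.
have := vol_truncated_polar_iter mmin; rewrite -Dm => H.
have {}H := le_trans vol_truncated_polar1 H.
have e1 : expR (8000 ^+ 2 * (n%:R * (1 - 2^-1 ^+ m))) <= expR (8000 ^+ 2) ^+ n :> R.
  rewrite -expRM_natl ler_expR mulrCA ler_pM2l ?(lt_le_trans ltr01 n1)//.
  by rewrite ler_piMr ?sqr_ge0// gerBl exprn_ge0.
have {}H := le_trans H (ler_wpM2r (vol_ge0 _) e1).
rewrite expRN -mulrAC exprMn exprVn ler_pdivrMr ?exprn_gt0 ?expR_gt0//.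
by rewrite [leRHS]mulrC.
Qed.

End reverse_santalo_core.

(** * Volume inequalities and linear images *)

Section volume_inequalities.
Context {R : realType} {n : nat}.
Implicit Types (x y z : 'rV[R]_n) (S K A : set 'rV[R]_n).
Local Notation mu := (lebesgue_rV R n).

(** The measure of [E] is computed by both slicings. For [y] in [K] the slice is [y - K], so the
    total is [|K|^2]; the slice at [x] is the intersection of [K] and [x + K], of volume at least
    [2^-n |K|] for [x] in half the difference body. *)
Lemma vol_difference_body_le K : compact K -> is_convex K -> 0 < vol K ->
  vol (difference_body K) <= 4 ^+ n * vol K.
Proof.
move=> cK cvK K0; have mK := compact_measurable_rV cK.
have cD := difference_body_compact cK; have mD := compact_measurable_rV cD.
pose E := [set p : 'rV[R]_n * 'rV[R]_n | K p.2 /\ K (p.2 - p.1)].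
have mE : measurable E.
  rewrite (_ : E = snd @^-1` K `&` (fun p => p.2 - p.1) @^-1` K)//.
  apply: measurableI.
    by rewrite -[X in measurable X]setTI; exact: measurable_snd.
  rewrite -[X in measurable X]setTI; apply: measurable_fun_rVP => // i.
  under eq_fun do rewrite !mxE.
  by apply: measurable_funB; apply: (measurableT_comp (measurable_coord_rV i));
    [exact: measurable_snd|exact: measurable_fst].
have swap : (\int[mu]_x mu (xsection E x) = \int[mu]_y mu (ysection E y))%E.
  have := @product_measure_unique _ _ _ _ _ mu mu (mu \x^ mu)%E
    (fun B C mB mC => product_measure2E mu mu mB mC) E mE.
  exact.
have upper : (\int[mu]_y mu (ysection E y) <= (vol K * vol K)%:E)%E.
  rewrite (_ : (fun y => _) = (cst (vol K)%:E) \_ K).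
    by rewrite -integral_mkcond integral_cst// [X in (_ * X)%E]vol_compact.
  apply/funext => y; rewrite patchE; case: ifPn => [/set_mem Ky|yK].
    have N1 : - 1 != 0 :> R by rewrite oppr_eq0 oner_neq0.
    have [_] := lebesgue_rV_homothety y N1 mK.
    rewrite normrN1 expr1n mul1e [X in _ = X]vol_compact// => <-.
    congr (mu _); apply/seteqP; split => [x|_ [w Kw <-]]; rewrite /ysection/= inE.
      by move=> [_ /= Kyx]; exists (y - x) => //; rewrite scaleN1r opprB subrK.
    by split => //=; rewrite scaleN1r opprD opprK addrCA addrN addr0.
  rewrite (_ : ysection E y = set0) ?measure0//.
  apply/seteqP; split => // x; rewrite /ysection/= inE => -[/= Ky _].
  by move/negP: yK; rewrite inE.
have half0 : 2^-1 != 0 :> R by rewrite invr_eq0 pnatr_eq0.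
have [mH muH] := lebesgue_rV_homothety 0 half0 mD.
set H := [set 2^-1 *: x + 0 | x in difference_body K] in mH muH.
have lower : ((2^-1 ^+ n * vol K * (2^-1 ^+ n * vol (difference_body K)))%:E <=
    \int[mu]_x mu (xsection E x))%E.
  apply: (@le_trans _ _ (\int[mu]_(x in H) mu (xsection E x))%E); last first.
    apply: ge0_subset_integral => //.
    exact: measurable_fun_xsection.
  apply: (@le_trans _ _ (\int[mu]_(x in H) (2^-1 ^+ n * vol K)%:E)%E).
    rewrite integral_cst// [X in (_ * X)%E]muH ger0_norm ?invr_ge0//.
    by rewrite [X in (_ * (_ * X))%E]vol_compact// -!EFinM.
  apply: ge0_le_integral => //.
  - by move=> x _; rewrite lee_fin mulr_ge0 ?vol_ge0 ?exprn_ge0.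
  - by apply: measurable_funTS; exact: measurable_fun_xsection.
  move=> _ [_ [a Ka [b Kb <-]] <-].
  have [mG] := lebesgue_rV_homothety (2^-1 *: a) half0 mK.
  rewrite ger0_norm ?invr_ge0// [X in (_ * X)%E]vol_compact// -EFinM => <-.
  apply: le_measure; rewrite ?inE//; first exact: measurable_xsection.
  have t01 : 0 <= (2^-1 : R) <= 1 by lra.
  have h : 1 - 2^-1 = 2^-1 :> R by lra.
  move=> _ [w Kw <-]; rewrite /xsection /= inE; split => /=.
    by have := cvK _ _ _ t01 Kw Ka; rewrite h.
  have := cvK _ _ _ t01 Kw Kb; rewrite h; congr K.
  by apply/rowP => i; rewrite !mxE; ring.
have := le_trans lower _; rewrite swap => /(_ _ upper); rewrite lee_fin.
have K2 : 0 < 2^-1 ^+ n * 2^-1 ^+ n * vol K by rewrite !mulr_gt0 ?exprn_gt0 ?invr_gt0.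
have -> : 2^-1 ^+ n * vol K * (2^-1 ^+ n * vol (difference_body K)) =
    2^-1 ^+ n * 2^-1 ^+ n * vol K * vol (difference_body K) by ring.
have -> : vol K * vol K = 2^-1 ^+ n * 2^-1 ^+ n * vol K * (4 ^+ n * vol K).
  have : 2^-1 ^+ n * 2^-1 ^+ n * 4 ^+ n = 1 :> R.
    by rewrite -!exprMn (_ : 2^-1 * 2^-1 * 4 = 1) ?expr1n//; field.
  move=> E4; rewrite (_ : _ * (4 ^+ n * _) = 2^-1 ^+ n * 2^-1 ^+ n * 4 ^+ n *
    (vol K * vol K)); last by ring.
  by rewrite E4 mul1r.
by rewrite ler_pM2l.
Qed.

Lemma mulmx_unit_bij (T : {linear 'rV[R]_n -> 'rV[R]_n}) :
  bijective T -> lin1_mx T \in unitmx.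
Proof.
move=> bT; rewrite -row_free_unit; apply/inj_row_free => v.
rewrite mul_rV_lin1 => Tv; apply: (bij_inj bT).
by rewrite Tv linear0.
Qed.

Lemma vol_mulmx_preimage (M : 'M[R]_n) A : M \in unitmx -> measurable A ->
  vol ((fun x => x *m M) @^-1` A) = `|\det M|^-1 * vol A.
Proof.
move=> uM mA; have [_ _ ME] := scales_lebesgue_affine 0 uM.
rewrite /vol (_ : _ @^-1` A = (fun x => x *m M + 0) @^-1` A).
  have c0 : (0 < `|\det M|^-1%:E)%E.
    rewrite lte_fin invr_gt0 normr_gt0.
    by move: uM; rewrite unitmxE unitfE.
  (* An infinite measure stays infinite after scaling, and [fine] sends both sides to 0. *)
  rewrite ME//; case: (mu A) => [a| |] //=.
    by rewrite gt0_muley// mulr0.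
  by rewrite gt0_muleNy// mulr0.
by apply/seteqP; split => x /=; rewrite addr0.
Qed.

Lemma mulmx_imageE (M : 'M[R]_n) A : M \in unitmx ->
  [set x *m M | x in A] = (fun x => x *m invmx M) @^-1` A.
Proof.
move=> uM; apply/seteqP; split => [_ [x Ax <-]|x Ax] /=.
  by rewrite mulmxK.
by exists (x *m invmx M) => //; rewrite mulmxKV.
Qed.

Lemma vol_mulmx_image (M : 'M[R]_n) A : M \in unitmx -> measurable A ->
  vol [set x *m M | x in A] = `|\det M| * vol A.
Proof.
move=> uM mA; rewrite mulmx_imageE// vol_mulmx_preimage ?unitmx_inv//.
by rewrite det_inv normfV invrK.
Qed.

Lemma dotmul_mulmx (M : 'M[R]_n) x y : dotmul (x *m M) y = dotmul x (y *m M^T).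
Proof.
have dE u v : dotmul u v = (u *m v^T) 0 0.
  by rewrite mxE; apply: eq_bigr => i _; rewrite mxE.
by rewrite !dE trmx_mul trmxK mulmxA.
Qed.

Lemma polar_mulmx_image (M : 'M[R]_n) A :
  polar [set x *m M | x in A] = (fun y => y *m M^T) @^-1` polar A.
Proof.
apply/seteqP; split => y /= Ay x Ax.
  by rewrite -dotmul_mulmx; apply: Ay; exists x.
by case: Ax => z Az <-; rewrite dotmul_mulmx; exact: Ay.
Qed.

(** The polar transforms by the inverse transpose, so the two determinants cancel. *)
Lemma vol_product_mulmx (M : 'M[R]_n) A : M \in unitmx -> measurable A ->
  vol_product [set x *m M | x in A] = vol_product A.
Proof.
move=> uM mA; rewrite /vol_product vol_mulmx_image// polar_mulmx_image.
rewrite vol_mulmx_preimage ?unitmx_tr//; last first.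
  by apply: closed_measurable_rV; exact: polar_closed.
rewrite det_tr mulrACA mulfV ?mul1r// normr_eq0.
by move: uM; rewrite unitmxE unitfE.
Qed.

(** Markov's inequality: the part [C] outside the ball satisfies [r^2 |C| <= r^2 |S| / 4]. *)
Lemma vol_setI_ball_ge S r : compact S -> 0 < r ->
  4 * \int[mu]_(x in S) norm2 x ^+ 2 <= vol S * r ^+ 2 ->
  3 / 4 * vol S <= vol (S `&` [set x | norm2 x <= r]).
Proof.
move=> cS r0 Sr; have mS := compact_measurable_rV cS.
have cB := compact_setI_ball (r := r) cS.
set B := S `&` _ in cB *; have mB := compact_measurable_rV cB.
pose C := S `\` B; have mC : measurable C by exact: measurableD.
have [M M0 SM] := compact_norm2_bounded cS.
have mf A : measurable_fun A (fun x => (norm2 x ^+ 2)%:E).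
  apply: measurable_funTS; apply/measurable_EFinP.
  under eq_fun do rewrite sqr_norm2.
  exact: measurable_sqr_norm2.
have f0 x : (0 <= (norm2 x ^+ 2)%:E)%E by rewrite lee_fin sqr_ge0.
(* The real integral in the hypothesis is [fine] of this one, so finiteness lets the two be
   identified. *)
have fin : (\int[mu]_(x in S) (norm2 x ^+ 2)%:E < +oo)%E.
  apply: (@le_lt_trans _ _ (\int[mu]_(x in S) (M ^+ 2)%:E)%E).
    apply: ge0_le_integral => // x Sx.
    by rewrite lee_fin ler_pXn2r ?nnegrE ?norm2_ge0 ?(ltW M0) ?SM.
  by rewrite integral_cst// [X in (_ * X)%E]vol_compact// -EFinM ltry.
have SE : mu S = (mu B + mu C)%E.
  rewrite -measureU//; last by rewrite /C setDIK.
  by rewrite /C setDUK// /B; exact: subIsetl.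
have CE : ((r ^+ 2)%:E * mu C <= \int[mu]_(x in S) (norm2 x ^+ 2)%:E)%E.
  apply: (@le_trans _ _ (\int[mu]_(x in C) (norm2 x ^+ 2)%:E)%E); last first.
    by apply: ge0_subset_integral => //; exact: subDsetl.
  rewrite -integral_cst//; apply: ge0_le_integral => //.
    by move=> x _; rewrite lee_fin sqr_ge0.
  move=> x [Sx nBx]; rewrite lee_fin ler_pXn2r ?nnegrE ?norm2_ge0 ?(ltW r0)//.
  by rewrite leNgt; apply/negP => xr; apply: nBx; split => //; exact: ltW.
have Cfin : mu C \is a fin_num.
  rewrite ge0_fin_numE//; apply: (@le_lt_trans _ _ (mu S)).
    by rewrite SE leeDr.
  exact: compact_lebesgue_lty.
rewrite /Rintegral in Sr; set I := (\int[mu]_(x in S) _)%E in fin CE Sr.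
have Ifin : I \is a fin_num by rewrite ge0_fin_numE// integral_ge0.
have SE' : vol S = vol B + fine (mu C).
  by apply: EFin_inj; rewrite EFinD (fineK Cfin) -(vol_compact cS) -(vol_compact cB).
move: CE; rewrite -(fineK Cfin) -(fineK Ifin) -EFinM lee_fin => CE.
have r20 : 0 < r ^+ 2 by rewrite exprn_gt0.
have : 4 * fine (mu C) <= vol S by rewrite -(ler_pM2r r20); lra.
lra.
Qed.

End volume_inequalities.

(** * Affine positions and the second moment *)

Lemma powR_root (R : realType) (n : nat) (x : R) : (0 < n)%N -> 0 <= x ->
  (x `^ (1 / n%:R)) ^+ n = x.
Proof.
move=> n0 x0; rewrite -powR_mulrn ?powR_ge0// -powRrM divfK ?powRr1//.
by rewrite pnatr_eq0 -lt0n.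
Qed.

Section positions.
Context {R : realType} {n : nat}.
Implicit Types (x y b : 'rV[R]_n) (S K : set 'rV[R]_n) (M : 'M[R]_n).

Lemma mulmx_continuous M : continuous (fun x => x *m M).
Proof.
rewrite (_ : (fun x => _) = (fun x => \sum_i x ord0 i *: row i M)).
  apply: continuous_sum => i x; apply: continuousZl.
  exact: coord_continuous.
by apply/funext => x; rewrite mulmx_sum_row.
Qed.

Lemma affine_compact M b K : compact K -> compact [set (x - b) *m M | x in K].
Proof.
move=> cK; apply: continuous_compact => //; apply: continuous_subspaceT => x.
apply: (@continuous_comp _ _ _ (fun x => x - b) (fun x => x *m M)); last first.
  exact: mulmx_continuous.
by apply: continuousB; [exact: cvg_id|exact: cst_continuous].
Qed.

Lemma affine_convex M b K : is_convex K -> is_convex [set (x - b) *m M | x in K].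
Proof.
move=> cK t _ _ t01 [x Kx <-] [y Ky <-].
exists (t *: x + (1 - t) *: y); first exact: cK.
rewrite !scalemxAl -mulmxDl; congr (_ *m M).
by apply/rowP => i; rewrite !mxE; ring.
Qed.

Lemma affine_interior M b K : M \in unitmx -> K° !=set0 ->
  [set (x - b) *m M | x in K]° !=set0.
Proof.
move=> uM [x Kx]; exists ((x - b) *m M).
have -> : [set (x - b) *m M | x in K] = (fun y => y *m invmx M + b) @^-1` K.
  apply/seteqP; split => [_ [y Ky <-]|y Ky] /=; first by rewrite mulmxK// subrK.
  by exists (y *m invmx M + b) => //; rewrite addrK mulmxKV.
have cf : {for (x - b) *m M, continuous (fun y => y *m invmx M + b)}.
  by apply: continuousD; [exact: mulmx_continuous|exact: cst_continuous].
by apply: cf; rewrite mulmxK// subrK.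
Qed.

Lemma vol_interior_gt0 K : (0 < n)%N -> compact K -> K° !=set0 -> 0 < vol K.
Proof.
move=> n0 cK [x /interior_norm2_ball[eta eta0 etaK]].
apply: lt_le_trans (vol_ge_ball n0 eta0 cK etaK).
by rewrite exprn_gt0// !mulr_gt0// invr_gt0 sqrtr_gt0 ltr0n.
Qed.

Lemma vol_le_difference_body S : compact S -> S !=set0 ->
  vol S <= vol (difference_body S).
Proof.
move=> cS [x Sx]; have mS := compact_measurable_rV cS.
have [mT muT] := lebesgue_rV_homothety (- x) (oner_neq0 R) mS.
have -> : vol S = vol [set 1 *: y - x | y in S].
  by rewrite /vol muT normr1 expr1n mul1e.
apply: le_vol => //; first exact: difference_body_compact.
by move=> _ [y Sy <-]; exists y => //; exists x; rewrite ?scale1r.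
Qed.

Lemma vol_product_difference_body_gt0 S : (0 < n)%N -> compact S -> S° !=set0 ->
  0 < vol_product (difference_body S).
Proof.
move=> n0 cS iS; have cD := difference_body_compact cS.
have [eta eta0 etaD] := difference_body_ball iS.
have rn0 : 0 < Num.sqrt n%:R :> R by rewrite sqrtr_gt0 ltr0n.
apply: mulr_gt0.
  apply: lt_le_trans (vol_ge_ball (x := 0) n0 eta0 cD _).
    by rewrite exprn_gt0// !mulr_gt0// invr_gt0.
  by move=> y; rewrite add0r; exact: etaD.
have [M M0 DM] := compact_norm2_bounded cD.
have M0' : 0 < M^-1 by rewrite invr_gt0.
apply: lt_le_trans (vol_ge_ball (x := 0) n0 M0' (polar_compact eta0 etaD) _).
  by rewrite exprn_gt0// !mulr_gt0// invr_gt0.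
move=> y yM x Dx; rewrite add0r (le_trans (dotmul_le x y))//.
rewrite (le_trans (ler_pM (norm2_ge0 x) (norm2_ge0 y) (DM _ Dx) yM))//.
by rewrite mulfV// gt_eqF.
Qed.

(** Any radius admissible for Markov's inequality obeys [key], obtained from the polar bound and
    [|S| <= |S - S|] by taking [n]-th roots. A radius violating [key] is thus inadmissible, which
    bounds the second moment from below. *)
Lemma second_moment_ge S : (0 < n)%N -> compact S -> is_convex S -> S° !=set0 ->
  expR (- 8000 ^+ 2) / 2 /
    (Num.sqrt n%:R * vol_product (difference_body S) `^ (1 / n%:R)) <=
  Num.sqrt ((vol S `^ (1 + 2 / n%:R))^-1 *
    \int[lebesgue_rV R n]_(x in S) norm2 x ^+ 2).
Proof.
move=> n0 cS cvS iS.
have S0 := vol_interior_gt0 n0 cS iS.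
have rn0 : 0 < Num.sqrt n%:R :> R by rewrite sqrtr_gt0 ltr0n.
have sp := vol_product_difference_body_gt0 n0 cS iS.
set s := vol_product _ in sp *; set I := Rintegral _ _ _.
set c := expR _; have c0 : 0 < c by exact: expR_gt0.
set al := vol S `^ (1 / n%:R).
have al0 : 0 < al by rewrite powR_gt0.
have aln : al ^+ n = vol S by rewrite powR_root// ltW.
set be := s `^ (1 / n%:R).
have be0 : 0 < be by rewrite powR_gt0.
have ben : be ^+ n = s by rewrite powR_root// ltW.
have key r : 0 < r -> 4 * I <= vol S * r ^+ 2 ->
    2 * c * al <= r * Num.sqrt n%:R * be.
  move=> r0 Ir; have Sr := vol_setI_ball_ge cS r0 Ir.
  have H := vol_polar_difference_body_ge n0 cS cvS iS S0 Sr r0.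
  have SD : vol S <= vol (difference_body S).
    apply: vol_le_difference_body => //.
    by have [x /interior_subset Sx] := iS; exists x.
  have q0 : 0 <= 2 * c / (r * Num.sqrt n%:R).
    by rewrite divr_ge0// mulr_ge0// ltW.
  have {}H : al * (2 * c / (r * Num.sqrt n%:R)) <= be.
    rewrite -(@ler_pXn2r _ n)// ?nnegrE ?(mulr_ge0 (ltW al0) q0) ?(ltW be0)//.
    rewrite exprMn aln ben; apply: ler_pM => //; first exact: ltW.
    exact: exprn_ge0.
  have rr0 : 0 < r * Num.sqrt n%:R by rewrite mulr_gt0.
  move: H; rewrite [X in X <= _]mulrC mulrAC ler_pdivrMr//.
  by rewrite [X in _ <= X]mulrC.
(* Half the smallest radius compatible with [key]. *)
pose r := c * al / (Num.sqrt n%:R * be).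
have r0 : 0 < r by rewrite divr_gt0 ?mulr_gt0.
have rE : r * Num.sqrt n%:R * be = c * al.
  by rewrite /r -[X in X = _]mulrA divfK// gt_eqF// mulr_gt0.
have Ir : vol S * r ^+ 2 <= 4 * I.
  rewrite leNgt; apply/negP => /ltW /(key _ r0); rewrite rE leNgt -mulrA.
  by rewrite ltr_pMl ?mulr_gt0// ltr1n.
have volE : vol S `^ (1 + 2 / n%:R) = vol S * al ^+ 2.
  rewrite powRD; last by rewrite gt_eqF ?implybT.
  rewrite powRr1 ?(ltW S0)// -powR_mulrn ?(ltW al0)// -powRrM.
  by congr (_ * _ `^ _); rewrite div1r mulrC.
rewrite -(@ler_pXn2r _ 2)// ?nnegrE ?sqrtr_ge0 ?divr_ge0 ?mulr_ge0
  ?(ltW rn0) ?(ltW be0) ?(ltW c0)//.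
rewrite sqr_sqrtr; last first.
  rewrite mulr_ge0 ?invr_ge0 ?powR_ge0//.
  by apply: Rintegral_ge0 => x _; rewrite sqr_ge0.
rewrite volE ler_pdivlMl ?mulr_gt0 ?exprn_gt0//.
apply: (@le_trans _ _ (vol S * r ^+ 2 / 4)); last by rewrite ler_pdivrMr//; lra.
rewrite le_eqVlt; apply/orP; left; apply/eqP.
by rewrite /r; field; rewrite !gt_eqF.
Qed.

End positions.

(** * The two inequalities *)

Theorem theorem1p1 (R : realType) :
  exists2 c1 : R, 0 < c1 &
    forall (n : nat) (K : set 'rV[R]_n), (1 <= n)%N ->
      convex_body K -> K° 0 ->
      4 * n%:R * vol_product K `^ (1 / n%:R)
        >= n%:R * vol_product (difference_body K) `^ (1 / n%:R) /\
      n%:R * vol_product (difference_body K) `^ (1 / n%:R)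
        >= c1 / isotropic_constant K.
Proof.
exists (expR (- 8000 ^+ 2) / 2); first by rewrite divr_gt0 ?expR_gt0.
set c := _ / 2 => n K n0 [/convex_set_is_convex cvK cK iK] K0.
have n1 : 0 < n%:R :> R by rewrite ltr0n.
have rn0 : 0 < Num.sqrt n%:R :> R by rewrite sqrtr_gt0.
have cD := difference_body_compact cK; have mD := compact_measurable_rV cD.
have sp := vol_product_difference_body_gt0 n0 cK iK.
have bp : 0 < vol_product (difference_body K) `^ (1 / n%:R) by rewrite powR_gt0.
split.
  (* A ball around 0 in [K] makes the polar of [K] compact, so that volumes of its subsets can be
     compared by [le_vol]. *)
  have [eta eta0 etaK] := interior_norm2_ball K0.
  have cP : compact (polar K).
    by apply: (polar_compact eta0) => y /etaK; rewrite add0r.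
  have KD : K `<=` difference_body K.
    by move=> x Kx; exists x => //; exists 0; [exact: interior_subset|rewrite subr0].
  have vK : 0 <= vol_product K by rewrite mulr_ge0 ?vol_ge0.
  rewrite (mulrC 4) -mulrA ler_pM2l//.
  rewrite -(@ler_pXn2r _ n)// ?nnegrE ?mulr_ge0 ?powR_ge0//.
  rewrite exprMn !powR_root// ?(ltW sp)// /vol_product mulrA.
  apply: ler_pM; rewrite ?vol_ge0//.
    by apply: vol_difference_body_le => //; exact: vol_interior_gt0.
  apply: le_vol => //; last exact: polarS.
  by apply: closed_measurable_rV; exact: polar_closed.
have pos (T : {linear 'rV[R]_n -> 'rV[R]_n}) : bijective T ->
    c / (Num.sqrt n%:R * vol_product (difference_body K) `^ (1 / n%:R)) <=
    Num.sqrt ((vol (T @` centered K) `^ (1 + 2 / n%:R))^-1 *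
         \int[lebesgue_rV R n]_(x in T @` centered K) norm2 x ^+ 2).
  move=> bT; have uM := mulmx_unit_bij bT; set M := lin1_mx T in uM.
  have -> : T @` centered K = [set (x - barycenter K) *m M | x in K].
    apply/seteqP; split => [_ [_ [x Kx <-] <-]|_ [x Kx <-]].
      by exists x => //; rewrite mul_rV_lin1.
    by exists (x - barycenter K); [exists x|rewrite mul_rV_lin1].
  set S := [set _ | _ in K].
  (* The barycenter cancels in differences, and the linear part preserves the volume product. *)
  have -> : vol_product (difference_body K) = vol_product (difference_body S).
    rewrite -(vol_product_mulmx uM mD); congr vol_product.
    apply/seteqP; split => [_ [_ [x Kx [y Ky <-]] <-]|_ [_ [x Kx <-] [_ [y Ky <-] <-]]].
      exists ((x - barycenter K) *m M); first by exists x.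
      exists ((y - barycenter K) *m M); first by exists y.
      by rewrite -mulmxBl opprB addrA subrK.
    exists (x - y); first by exists x => //; exists y.
    by rewrite -mulmxBl opprB addrA subrK.
  apply: second_moment_ge => //; first exact: affine_compact.
    exact: affine_convex.
  exact: affine_interior.
have c0 : 0 < c by rewrite divr_gt0 ?expR_gt0.
clearbody c; set be := vol_product _ `^ _ in bp pos *.
have L : c / (n%:R * be) <= isotropic_constant K.
  rewrite /isotropic_constant ler_pdivlMl//.
  apply: lb_le_inf.
    (* The identity shows that the infimum is over a nonempty set, so a lower bound passes to it. *)
    pose T0 : {linear 'rV[R]_n -> 'rV[R]_n} := idfun.
    have bT0 : bijective T0 by exists idfun.
    by eexists; exists T0.
  move=> _ [T bT <-]; apply: le_trans (pos T bT).
  rewrite -[X in X * be](sqr_sqrtr (ltW n1)) le_eqVlt; apply/orP; left.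
  by apply/eqP; field; rewrite !gt_eqF.
(* Positivity permits exchanging the isotropic constant with the other denominator. *)
have L0 : 0 < isotropic_constant K.
  by apply: lt_le_trans L; exact: divr_gt0 c0 (mulr_gt0 n1 bp).
by rewrite ler_pdivrMr// mulrC -ler_pdivrMr// mulr_gt0.
Qed.
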